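(* For any $k\in\mathbb Z_+/2$, one has $$\sum_n\begin{pmatrix}a&b&n\\ c&k&j\end{pmatrix}\,(v_{b,\,b-n+a}\otimes v_{c,\,c-k+n})=J_{bc}^{-1}(k)\,\phi_j^{bc}\,v_{j,\,j-k+a},$$ where the coefficients are the 6j-symbols of $sl(2)$ and $J_{bc}(\lambda)$ is the fusion matrix for the $sl(2)$-modules $V_b$ and $V_c$.
   Context: $\mathbb Z_+$ is the set of nonnegative integers. $V_a$, $a\in\mathbb Z_+/2$, is the irreducible representation of $sl(2)$ of spin $a$, with highest weight vector $v_a$; $v_{a,n}=f^nv_a$, where $e,f,h$ are the standard generators. $\phi_a^{bc}:V_a\to V_b\otimes V_c$ is the intertwiner such that $\phi_a^{bc}v_a=v_b\otimes v_{c,b+c-a}+$ lower order terms. The 6j-symbols (in this normalization, which differs from the more common one) are defined by $$(1\otimes\phi_j^{bc})\phi_k^{aj}=\sum_n\begin{pmatrix}a&b&n\\ c&k&j\end{pmatrix}(\phi_n^{ab}\otimes1)\phi_k^{nc},$$ and the 6j-symbols not defined in this way are defined to be zero. Fusion matrix: let $\lambda\in\mathbb C$ denote a spin, and let $M_\lambda$ be the Verma module over $sl(2)$ with highest weight vector $v_\lambda$, $hv_\lambda=2\lambda v_\lambda$. For a finite dimensional module $V$ and $v\in V$ with $hv=2\lambda_vv$, for generic $\lambda$ let $\Phi^v_\lambda:M_\lambda\to M_{\lambda-\lambda_v}\otimes V$ be the unique intertwiner with $\Phi^v_\lambda v_\lambda=v_{\lambda-\lambda_v}\otimes v+$ terms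 with lower weight vectors in the first factor. $J_{bc}(\lambda)=J_{V_b,V_c}(\lambda):V_b\otimes V_c\to V_b\otimes V_c$ is the rational function of $\lambda$ defined by $J_{bc}(\lambda)(w\otimes v)=u$ where $(\Phi^w_{\lambda-\lambda_v}\otimes1)\Phi^v_\lambda=\Phi^u_\lambda$ for weight vectors $w\in V_b$, $v\in V_c$.
   Formalization: φ_j^{bc} and φ_k^{aj} are assumed to exist; the identity is stated literally if J_bc^{-1} is regular at k on the weight space of spin k-a, and for every k in the form: J_bc(λ) applied to the left side is regular at λ=k with value φ_j^{bc}v_{j,j-k+a}. *)

(* Defs.v *)
From HB Require Import structures.
From mathcomp Require Import all_boot all_order all_algebra.
From mathcomp Require Import ring boolp classical_sets.

Set Implicit Arguments.
Unset Strict Implicit.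
Unset Printing Implicit Defensive.

Import GRing.Theory.
Local Open Scope ring_scope.

(* A spin in Z_+/2 is encoded by its double: the capital letter A : nat stands
   for the spin a = A/2. *)

Record sl2mod (F : fieldType) := Sl2Mod {
  sl2car :> lmodType F;
  sl2e : {linear sl2car -> sl2car};
  sl2f : {linear sl2car -> sl2car};
  sl2h : {linear sl2car -> sl2car};
  sl2_ef : forall x, sl2e (sl2f x) - sl2f (sl2e x) = sl2h x;
  sl2_he : forall x, sl2h (sl2e x) - sl2e (sl2h x) = 2 *: sl2e x;
  sl2_hf : forall x, sl2h (sl2f x) - sl2f (sl2h x) = - (2 *: sl2f x) }.

Definition intertwiner (F : fieldType) (M N : sl2mod F) (g : M -> N) : Prop :=
  [/\ linear g,
      forall x, g (sl2e M x) = sl2e N (g x),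
      forall x, g (sl2f M x) = sl2f N (g x) &
      forall x, g (sl2h M x) = sl2h N (g x)].

Section Trivial.
Variable F : fieldType.

Definition triv0 (x : F^o) : F^o := 0.
Fact triv0_linear : linear triv0.
Proof. by move=> c x y; rewrite /triv0 scaler0 addr0. Qed.
HB.instance Definition _ := GRing.isLinear.Build F F^o F^o _ triv0 triv0_linear.
Fact triv_ef x : triv0 (triv0 x) - triv0 (triv0 x) = triv0 x.
Proof. exact: subrr. Qed.
Fact triv_he x : triv0 (triv0 x) - triv0 (triv0 x) = 2 *: triv0 x.
Proof. by rewrite subrr /triv0 scaler0. Qed.
Fact triv_hf x : triv0 (triv0 x) - triv0 (triv0 x) = - (2 *: triv0 x).
Proof. by rewrite subrr /triv0 scaler0 oppr0. Qed.

Definition triv : sl2mod F := Sl2Mod triv_ef triv_he triv_hf.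

End Trivial.

Section Verma.
Variables (F : fieldType) (lam : F).

(* 'X^i stands for f^i v_lam, hence e 'X^i = i (2 lam - i + 1) 'X^(i-1) and
   h 'X^i = (2 lam - 2 i) 'X^i. *)
Definition verma_e (p : {poly F}) : {poly F} :=
  (2 * lam) *: p^`() - 'X * p^`()^`().
Definition verma_f (p : {poly F}) : {poly F} := 'X * p.
Definition verma_h (p : {poly F}) : {poly F} :=
  (2 * lam) *: p - 2 *: ('X * p^`()).

Fact verma_e_linear : linear verma_e.
Proof. by move=> c p q; rewrite /verma_e !linearP /= -!mul_polyC; ring. Qed.
Fact verma_f_linear : linear verma_f.
Proof. by move=> c p q; rewrite /verma_f -!mul_polyC; ring. Qed.
Fact verma_h_linear : linear verma_h.
Proof. by move=> c p q; rewrite /verma_h !linearP /= -!mul_polyC; ring. Qed.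
HB.instance Definition _ :=
  GRing.isLinear.Build F {poly F} {poly F} _ verma_e verma_e_linear.
HB.instance Definition _ :=
  GRing.isLinear.Build F {poly F} {poly F} _ verma_f verma_f_linear.
HB.instance Definition _ :=
  GRing.isLinear.Build F {poly F} {poly F} _ verma_h verma_h_linear.

Fact verma_ef p : verma_e (verma_f p) - verma_f (verma_e p) = verma_h p.
Proof.
rewrite /verma_e /verma_f /verma_h !(derivM, derivX, derivD, mul1r).
by rewrite -!mul_polyC; ring.
Qed.
Fact verma_he p : verma_h (verma_e p) - verma_e (verma_h p) = 2 *: verma_e p.
Proof.
rewrite /verma_e /verma_h !(derivB, derivZ, derivM, derivX, derivD, mul1r).
by rewrite -!mul_polyC; ring.
Qed.
Fact verma_hf p : verma_h (verma_f p) - verma_f (verma_h p) = - (2 *: verma_f p).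
Proof.
rewrite /verma_f /verma_h !(derivM, derivX, derivD, mul1r).
by rewrite -!mul_polyC; ring.
Qed.

Definition verma : sl2mod F := Sl2Mod verma_ef verma_he verma_hf.

End Verma.

Section Irreducible.
Variables (F : fieldType) (C : nat).

(* Matrices (acting on columns) of e, f, h on V_c in the basis
   v_{c,i} = f^i v_c, 0 <= i <= 2c. *)
Definition irr_e : 'M[F]_C.+1 :=
  \matrix_(i, j) if i.+1 == j :> nat then (j * (C.+1 - j))%:R else 0.
Definition irr_f : 'M[F]_C.+1 :=
  \matrix_(i, j) if i == j.+1 :> nat then 1 else 0.
Definition irr_h : 'M[F]_C.+1 :=
  \matrix_(i, j) if i == j then C%:R - 2 * i%:R else 0.

Fact irr_ef : irr_e *m irr_f - irr_f *m irr_e = irr_h.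
Proof.
apply/matrixP => i k; rewrite !mxE.
have -> : \sum_j irr_e i j * irr_f j k =
    if i == k then (k.+1 * (C - k))%:R else 0 :> F.
  have [kC|Ck] := ltnP k C.
    rewrite (bigD1 (Ordinal (kC : k.+1 < C.+1)%N)) //= big1 => [|j].
      rewrite !mxE /= eqxx mulr1 addr0 eqSS subSS.
      by rewrite -(inj_eq val_inj).
    move=> jk; rewrite !mxE; case: (j =P k.+1 :> nat) => [e|]; last first.
      by rewrite mulr0.
    by case/eqP: jk; apply: val_inj.
  rewrite big1 => [|j _].
    by move: Ck; rewrite -subn_eq0 => /eqP ->; rewrite muln0 if_same.
  rewrite !mxE; case: (j =P k.+1 :> nat) => [e|]; last by rewrite mulr0.
  by have := ltn_ord j; rewrite [X in (X < _)%N]e ltnS ltnNge Ck.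
have -> : \sum_j irr_f i j * irr_e j k =
    if i == k then (k * (C.+1 - k))%:R else 0 :> F.
  case: k => [[|k] kC].
    rewrite big1 ?mul0n ?if_same // => j _.
    by rewrite !mxE /= mulr0.
  rewrite (bigD1 (Ordinal (ltnW kC))) //= big1 => [|j jk].
    by rewrite !mxE /= eqxx addr0 -(inj_eq val_inj) /=; case: ifP; rewrite ?mul1r ?mul0r.
  rewrite !mxE /= eqSS; case: (j =P k :> nat) => [e|]; last by rewrite mulr0.
  by case/eqP: jk; apply: val_inj.
case: eqP => [->|_]; last by rewrite subr0.
have kC : (k <= C)%N by rewrite -ltnS.
rewrite subSn // !natrM -[(C - k).+1]addn1 natrD natrB // -[k.+1]addn1 natrD.
by ring.
Qed.

Fact irr_he : irr_h *m irr_e - irr_e *m irr_h = 2 *: irr_e.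
Proof.
apply/matrixP => i k; rewrite !mxE (bigD1 i) //= big1 ?addr0; last first.
  by move=> j ji; rewrite !mxE eq_sym (negbTE ji) mul0r.
rewrite (bigD1 k) //= big1 ?addr0; last first.
  by move=> j jk; rewrite !mxE (negbTE jk) mulr0.
rewrite !mxE !eqxx; case: eqP => [<-|_]; last by rewrite !(mulr0, mul0r) subrr.
by rewrite -[i.+1]addn1 !natrD; ring.
Qed.

Fact irr_hf : irr_h *m irr_f - irr_f *m irr_h = - (2 *: irr_f).
Proof.
apply/matrixP => i k; rewrite !mxE (bigD1 i) //= big1 ?addr0; last first.
  by move=> j ji; rewrite !mxE eq_sym (negbTE ji) mul0r.
rewrite (bigD1 k) //= big1 ?addr0; last first.
  by move=> j jk; rewrite !mxE (negbTE jk) mulr0.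
rewrite !mxE !eqxx; case: eqP => [->|_]; last first.
  by rewrite !(mulr0, mul0r) subrr oppr0.
by rewrite -[k.+1]addn1 !natrD; ring.
Qed.

End Irreducible.

Section Tensor.
Variable F : fieldType.

Section Action.
Variables (M : sl2mod F) (C : nat).

(* {ffun 'I_C.+1 -> M} is the underlying space of M (x) V_c: the function x
   stands for \sum_i x_i (x) v_{c,i}. *)
Definition tens_op (g : M -> M) (G : 'M[F]_C.+1) (x : {ffun 'I_C.+1 -> M}) :
    {ffun 'I_C.+1 -> M} :=
  [ffun i => g (x i) + \sum_j G i j *: x j].

Fact tens_op_linear (g : {linear M -> M}) G : linear (tens_op g G).
Proof.
move=> c x y; apply/ffunP => i; rewrite !ffunE linearP scalerDr addrACA.
congr (_ + _); rewrite scaler_sumr -big_split; apply: eq_bigr => j _ /=.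
by rewrite !ffunE scalerDr !scalerA (mulrC c).
Qed.
HB.instance Definition _ (g : {linear M -> M}) G :=
  GRing.isLinear.Build F {ffun 'I_C.+1 -> M} {ffun 'I_C.+1 -> M} _
    (tens_op g G) (tens_op_linear g G).

Fact tens_op_comm (g1 g2 : {linear M -> M}) G1 G2 x i :
  (tens_op g1 G1 (tens_op g2 G2 x) - tens_op g2 G2 (tens_op g1 G1 x)) i =
  (g1 (g2 (x i)) - g2 (g1 (x i))) + \sum_j (G1 *m G2 - G2 *m G1) i j *: x j.
Proof.
have comp (g g' : {linear M -> M}) (G G' : 'M[F]_C.+1) :
    tens_op g G (tens_op g' G' x) i =
    g (g' (x i)) + \sum_j (G *m G') i j *: x j +
    (\sum_j G' i j *: g (x j) + \sum_j G i j *: g' (x j)).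
  rewrite !ffunE linearD -!addrA; congr (_ + _); rewrite addrCA.
  rewrite linear_sum; under eq_bigr do rewrite linearZ /=.
  congr (_ + _); under eq_bigr do rewrite ffunE scalerDr scaler_sumr.
  rewrite big_split /= addrC; congr (_ + _).
  rewrite exchange_big /=; apply: eq_bigr => j _; rewrite mxE scaler_suml.
  by apply: eq_bigr => k _; rewrite scalerA.
rewrite ffunE [in X in _ + X]ffunE !comp.
rewrite [X in _ + X - _]addrC opprD addrACA subrr addr0.
rewrite opprD addrACA; congr (_ + _); rewrite -sumrB; apply: eq_bigr => j _.
by rewrite !mxE scalerBl.
Qed.

Let te := tens_op (sl2e M) (irr_e F C).
Let tf := tens_op (sl2f M) (irr_f F C).
Let th := tens_op (sl2h M) (irr_h F C).

Fact tens_ef x : te (tf x) - tf (te x) = th x.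
Proof. by apply/ffunP => i; rewrite tens_op_comm irr_ef sl2_ef ffunE. Qed.
Fact tens_he x : th (te x) - te (th x) = 2 *: te x.
Proof.
apply/ffunP => i; rewrite tens_op_comm irr_he sl2_he !ffunE scalerDr scaler_sumr.
by congr (_ + _); apply: eq_bigr => j _; rewrite mxE scalerA.
Qed.
Fact tens_hf x : th (tf x) - tf (th x) = - (2 *: tf x).
Proof.
apply/ffunP => i; rewrite tens_op_comm irr_hf sl2_hf !ffunE scalerDr opprD.
congr (_ + _); rewrite scaler_sumr -sumrN.
by apply: eq_bigr => j _; rewrite !mxE scaleNr scalerA.
Qed.

Definition tens : sl2mod F := Sl2Mod tens_ef tens_he tens_hf.

End Action.

(* V_c, realised as F (x) V_c; thus tens (irr B) C is V_b (x) V_c. *)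
Definition irr (C : nat) : sl2mod F := tens (triv F) C.

Definition hwv (C : nat) : irr C := [ffun i => (i == ord0)%:R].
Definition vv (C n : nat) : irr C := iter n (sl2f (irr C)) (hwv C).

Definition tensv (M : sl2mod F) (C : nat) (x : M) (y : irr C) : tens M C :=
  [ffun i => (y i : F) *: x].

(* g (x) 1, for a map g that need not be an intertwiner. *)
Definition map_tens (M N : sl2mod F) (C : nat) (g : M -> N) (x : tens M C) :
    tens N C :=
  [ffun i => g (x i)].

(* 1 (x) g : M (x) V_j -> M (x) V_b (x) V_c. *)
Definition tens_map (M : sl2mod F) (J B C : nat) (g : irr J -> tens (irr B) C)
    (x : tens M J) : tens (tens M B) C :=
  [ffun q => [ffun p => \sum_(i < J.+1) (g (vv J i) q p : F) *: x i]].

(* x |-> coefficient of v_b in x. *)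
Definition irr_top (B : nat) (x : irr B) : triv F := x ord0.
(* x |-> coefficient of v_lam in x. *)
Definition verma_top (lam : F) (x : verma lam) : triv F := (x : {poly F})`_0.

Definition verma_hwv (lam : F) : verma lam := (1 : {poly F}).

(* The spins occurring in V_b (x) V_c, i.e. those a for which phi_a^{bc}
   exists. *)
Definition admissible (A B C : nat) : bool :=
  [&& ~~ odd (A + B + C), A <= B + C, B <= A + C & C <= A + B]%N.

(* The component in v_b (x) V_c of phi_a^{bc} v_a is v_b (x) v_{c,b+c-a}; all
   the other components are lower in the first factor. *)
Definition is_phi (A B C : nat) (g : irr A -> tens (irr B) C) : Prop :=
  intertwiner g /\
  map_tens (@irr_top B) (g (hwv A)) = vv C (B + C - A)./2.

Definition phi (A B C : nat) : irr A -> tens (irr B) C :=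
  xget (fun=> 0) (@is_phi A B C).
Arguments phi A B C _ : clear implicits.

Definition is_sixj (A B C K J : nat) (X : nat -> F) : Prop :=
  (forall N, ~~ (admissible N A B && admissible K N C) -> X N = 0) /\
  forall x : irr K,
    tens_map (phi J B C) (phi K A J x) =
    \sum_(N < (A + B).+1) X N *: map_tens (phi N A B) (phi K N C x).

(* The 6j-symbol with first row a, b, n and second row c, k, j; zero unless all
   the intertwiners in its defining identity exist. *)
Definition sixj (A B N C K J : nat) : F :=
  if admissible J B C && admissible K A J
  then xget (fun=> 0) (is_sixj A B C K J) N else 0.

(* "g = Phi^u_lam : M_lam -> N", where N = M_mu (x) U for some mu, and top
   sends v_mu (x) u + (terms lower in the first factor) to u. *)
Definition is_Phi (lam : F) (N U : sl2mod F) (top : N -> U) (u : U)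
    (g : verma lam -> N) : Prop :=
  intertwiner g /\ top (g (verma_hwv lam)) = u.

Definition generic (lam : F) : Prop := forall m : int, 2 * lam != m%:~R.

Definition ratcst (c : F) : {fraction {poly F}} := tofrac c%:P.

(* r is regular at x, with value y. *)
Definition ratval (r : {fraction {poly F}}) (x y : F) : Prop :=
  exists p q : {poly F},
    [/\ q.[x] != 0, r = tofrac p / tofrac q & y = p.[x] / q.[x]].

Definition regular_at (r : {fraction {poly F}}) (x : F) : Prop :=
  exists y, ratval r x y.

Definition rateval (x : F) (r : {fraction {poly F}}) : F :=
  xget 0 (ratval r x).

(* Coordinates in the basis v_{b,p} (x) v_{c,q} of V_b (x) V_c. *)
Definition coords (B C : nat) (u : tens (irr B) C) : 'cV[F]_(B.+1 * C.+1) :=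
  (mxvec (\matrix_(p, q) (u q p : F)))^T.

(* J is the matrix of the fusion matrix J_bc as a rational function of the
   spin: for v = v_{c,q} and w = v_{b,p}, lv and lw are the spins of v and w. *)
Definition is_fusion (B C : nat)
    (J : 'M[{fraction {poly F}}]_(B.+1 * C.+1)) : Prop :=
  forall lam : F, generic lam ->
    (forall s t, regular_at (J s t) lam) /\
    forall (p : 'I_B.+1) (q : 'I_C.+1),
      let lw := B%:R / 2 - p%:R in
      let lv := C%:R / 2 - q%:R in
      let mu := lam - lv in
      let nu := mu - lw in
      forall (u : tens (irr B) C)
             (gv : verma lam -> tens (verma mu) C)
             (gw : verma mu -> tens (verma nu) B),
        coords u =
          map_mx (rateval lam) J *m coords (tensv (vv B p) (vv C q)) ->
        is_Phi (map_tens (@verma_top mu)) (vv C q) gv ->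
        is_Phi (map_tens (@verma_top nu)) (vv B p) gw ->
        is_Phi (map_tens (map_tens (@verma_top nu))) u (map_tens gw \o gv).

Definition fusion (B C : nat) : 'M[{fraction {poly F}}]_(B.+1 * C.+1) :=
  xget 0 (@is_fusion B C).

(* Regularity at x of a matrix of rational functions on the weight subspace of
   V_b (x) V_c of spin b + c - s, spanned by the v_{b,p} (x) v_{c,q} with
   p + q = s. *)
Definition regular_on (B C : nat) (G : 'M[{fraction {poly F}}]_(B.+1 * C.+1))
    (s : nat) (x : F) : Prop :=
  forall (p : 'I_B.+1) (q : 'I_C.+1) t, (p + q)%N = s ->
    regular_at (G t (mxvec_index p q)) x.

End Tensor.

Arguments irr F C : clear implicits.
Arguments vv F C n : clear implicits.
Arguments phi F A B C _ : clear implicits.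
Arguments sixj F A B N C K J : clear implicits.
Arguments fusion F B C : clear implicits.

(* Main.v *)
(* The common idea is that a singular vector of M (x) V_c, with M cyclic on a
   singular vector m, is determined by its top coefficients, and is then given
   by an explicit product formula in the weight of m. For M a generic Verma
   module this gives the matrix J_bc(lam), whose columns are the top
   coefficients of the composites of two such intertwiners; for M = V_n the same
   formula, at lam = k, gives the top coefficients of
   (phi_n^{ab} (x) 1) phi_k^{nc}. The identity is therefore the top coefficient
   in V_a of the relation defining the 6j-symbols, once one knows that such
   symbols exist (the composites span the singular vectors of
   V_a (x) V_b (x) V_c) and that the columns of J_bc involved are regular at k. *)
Require Import Defs.
From HB Require Import structures.
From mathcomp Require Import all_boot all_order all_algebra.
From mathcomp Require Import ring zify boolp classical_sets.
From mathcomp Require Import reals complex.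

Set Implicit Arguments.
Unset Strict Implicit.
Unset Printing Implicit Defensive.

Import GRing.Theory.
Local Open Scope ring_scope.

(** * Intertwiners, singular vectors and local nilpotency of f *)

Section Modules.
Variable F : fieldType.
Implicit Types M N L : sl2mod F.

(** [intertwiner] carries linearity only as a proposition; packing the map gives access to the
    rewriting rules for bundled linear maps. *)
Lemma linear_packP (U V : lmodType F) (g : U -> V) :
  linear g -> exists g' : {linear U -> V}, g = g'.
Proof.
move=> lg; pose m := GRing.isLinear.Build F U V _ g lg.
by exists (HB.pack_for {linear U -> V} g m).
Qed.

Lemma intertwiner_comp M N L (g : M -> N) (g' : N -> L) :
  intertwiner g -> intertwiner g' -> intertwiner (g' \o g).
Proof.
move=> [gl ge gf gh] [gl' ge' gf' gh']; split=> [a x y|x|x|x] /=.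
- by rewrite gl gl'.
- by rewrite ge ge'.
- by rewrite gf gf'.
- by rewrite gh gh'.
Qed.

Lemma intertwiner_iterf M N (g : M -> N) m x :
  intertwiner g -> g (iter m (sl2f M) x) = iter m (sl2f N) (g x).
Proof. by case=> _ _ gf _; elim: m => //= m <-. Qed.

(* The weight of x is w, which is twice its spin. *)
Definition singular M (w : F) (x : M) :=
  sl2e M x = 0 /\ sl2h M x = w *: x.

Lemma singular_linear M w a (x y : M) :
  singular w x -> singular w y -> singular w (a *: x + y).
Proof.
by move=> [ex hx] [ey hy]; split; rewrite !linearP ?ex ?ey ?hx ?hy /=
  ?scaler0 ?addr0 // scalerDr !scalerA (mulrC a).
Qed.

Lemma singular_intertwiner M N w (g : M -> N) x :
  intertwiner g -> singular w x -> singular w (g x).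
Proof.
move=> [gl ge gf gh] [ex hx]; have [g' gE] := linear_packP gl.
by split; rewrite -?ge -?gh ?ex ?hx gE ?linear0 ?linearZ.
Qed.

Lemma h_iterf M (w : F) (x : M) m : sl2h M x = w *: x ->
  sl2h M (iter m (sl2f M) x) = (w - 2 * m%:R) *: iter m (sl2f M) x.
Proof.
move=> hx; elim: m => [|m IH]; first by rewrite mulr0 subr0.
rewrite iterS; move: (iter m _ x) IH => y hy.
have /(canRL (subrK _)) -> := sl2_hf y.
rewrite hy [sl2f M (_ *: _)]linearZ /= -scaleNr -scalerDl; congr (_ *: _).
by rewrite -[m.+1]addn1 natrD; ring.
Qed.

Lemma e_iterf M (w : F) (x : M) m : singular w x ->
  sl2e M (iter m.+1 (sl2f M) x) = (m.+1%:R * (w - m%:R)) *: iter m (sl2f M) x.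
Proof.
move=> [ex hx]; elim: m => [|m IH].
  have /(canRL (subrK _)) /= -> := sl2_ef x.
  by rewrite ex linear0 hx addr0 mul1r subr0.
rewrite iterS; have /(canRL (subrK _)) -> := sl2_ef (iter m.+1 (sl2f M) x).
rewrite IH (h_iterf _ hx) linearZ /= -scalerDl; congr (_ *: _).
by rewrite -[m.+2]addn1 -[m.+1]addn1 !natrD; ring.
Qed.

(** Stands in for finite dimensionality: it passes to tensor products and suffices to make the
    weights of singular vectors integral. *)
Definition f_nilpotent M := forall x, exists m, iter m (sl2f M) x = 0.

Lemma iterf0 M m : iter m (sl2f M) 0 = 0.
Proof. by elim: m => //= m ->; rewrite linear0. Qed.

Lemma iterf_linear M m : linear (iter m (sl2f M)).
Proof. by move=> a x y; elim: m => //= m ->; rewrite linearP. Qed.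

Lemma iterfZ M m a (x : M) :
  iter m (sl2f M) (a *: x) = a *: iter m (sl2f M) x.
Proof. by rewrite -[a *: x]addr0 iterf_linear iterf0 addr0. Qed.

Section CharZero.
Hypothesis F0 : [pchar F] =i pred0.

Lemma natrS_neq0 n : n.+1%:R != 0 :> F.
Proof. by rewrite (pcharf0P F).1. Qed.

Lemma natr_inj : injective (fun n => n%:R : F).
Proof.
move=> m n /eqP; wlog le_mn : m n / (m <= n)%N => [H|].
  by case/orP: (leq_total m n) => mn e; last symmetry;
    apply: H => //; rewrite eq_sym.
rewrite eq_sym -subr_eq0 -natrB // (pcharf0P F).1 // subn_eq0 => le_nm.
by apply/eqP; rewrite eqn_leq le_mn.
Qed.

(** For the least m with f^(m+1) x = 0, applying e gives (m+1)(w - m) f^m x = 0, which forces w = m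
    in characteristic zero. *)
Lemma singular_nat M (w : F) (x : M) : f_nilpotent M -> singular w x ->
  x != 0 -> exists2 n : nat, w = n%:R & iter n.+1 (sl2f M) x = 0.
Proof.
move=> fM sx x0; have xP : exists m, iter m (sl2f M) x == 0.
  by have [m /eqP] := fM x; exists m.
case: (ex_minnP xP) => [[|m] /eqP xm minm]; first by case/eqP: x0.
exists m => //; have := e_iterf m sx; rewrite xm linear0 => /esym/eqP.
rewrite scaler_eq0 mulf_eq0 (negbTE (natrS_neq0 _)) /= subr_eq0.
by case/orP=> [/eqP //|/minm]; rewrite ltnn.
Qed.

End CharZero.

(** * Components of tensor products *)

Section Tensor.
Variables (M : sl2mod F) (C : nat).
Implicit Types x y : tens M C.

(** Extension by zero to all natural indices, so that neighbouring components can be compared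
    without ordinals. *)
Definition tcomp (V : lmodType F) (x : {ffun 'I_C.+1 -> V}) (n : nat) : V :=
  if (n <= C)%N then x (inord n) else 0.

Lemma tcomp_ord (V : lmodType F) (x : {ffun 'I_C.+1 -> V}) (i : 'I_C.+1) :
  tcomp x i = x i.
Proof. by rewrite /tcomp inord_val -ltnS ltn_ord. Qed.

Lemma tcomp_ffun (V : lmodType F) (g : nat -> V) n :
  tcomp [ffun i : 'I_C.+1 => g i] n = if (n <= C)%N then g n else 0.
Proof. by rewrite /tcomp; case: leqP => // nC; rewrite ffunE inordK. Qed.

Lemma tcomp_gt (V : lmodType F) (x : {ffun 'I_C.+1 -> V}) n :
  (C < n)%N -> tcomp x n = 0.
Proof. by rewrite /tcomp ltnNge => /negbTE ->. Qed.

Lemma tcompP (V : lmodType F) (x y : {ffun 'I_C.+1 -> V}) :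
  tcomp x =1 tcomp y -> x = y.
Proof. by move=> xy; apply/ffunP=> i; rewrite -!tcomp_ord xy. Qed.

Lemma tcomp0 (V : lmodType F) n : tcomp (0 : {ffun 'I_C.+1 -> V}) n = 0.
Proof. by rewrite /tcomp ffunE if_same. Qed.

Lemma tcomp_linearP (V : lmodType F) a (x y : {ffun 'I_C.+1 -> V}) n :
  tcomp (a *: x + y) n = a *: tcomp x n + tcomp y n.
Proof.
rewrite /tcomp; case: ifP => _; first by rewrite !ffunE.
by rewrite scaler0 addr0.
Qed.

Lemma tcompZ (V : lmodType F) a (x : {ffun 'I_C.+1 -> V}) n :
  tcomp (a *: x) n = a *: tcomp x n.
Proof. by rewrite -[a *: x]addr0 tcomp_linearP tcomp0 addr0. Qed.

Lemma tcomp_map (V W : lmodType F) (g : {linear V -> W})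
    (x : {ffun 'I_C.+1 -> V}) n :
  tcomp [ffun i => g (x i)] n = g (tcomp x n).
Proof. by rewrite /tcomp; case: ifP; rewrite ?ffunE ?linear0. Qed.

Lemma tcomp_e x n :
  tcomp (sl2e (tens M C) x) n =
  sl2e M (tcomp x n) + (n.+1 * (C - n))%:R *: tcomp x n.+1.
Proof.
have [nC|Cn] := leqP n C; last first.
  by rewrite !tcomp_gt ?linear0 ?scaler0 ?addr0 // ltnW.
rewrite /tcomp nC ffunE; congr (_ + _); case: ltnP => nC'; last first.
  rewrite scaler0 big1 // => j _; rewrite !mxE inordK //.
  by case: eqP => [e|]; rewrite ?scale0r //; have := ltn_ord j; lia.
rewrite (bigD1 (inord n.+1)) //= big1 ?addr0 => [|j jn].
  by rewrite !mxE !inordK // eqxx subSS.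
rewrite !mxE inordK //; case: eqP => [e|]; rewrite ?scale0r //.
by case/eqP: jn; apply: val_inj; rewrite /= inordK.
Qed.

Lemma tcomp_f0 x : tcomp (sl2f (tens M C) x) 0 = sl2f M (tcomp x 0).
Proof.
rewrite /tcomp /= ffunE big1 ?addr0 // => j _; rewrite !mxE inordK //.
by rewrite scale0r.
Qed.

Lemma tcomp_fS x n : (n < C)%N ->
  tcomp (sl2f (tens M C) x) n.+1 = sl2f M (tcomp x n.+1) + tcomp x n.
Proof.
move=> nC; rewrite /tcomp nC (ltnW nC) ffunE; congr (_ + _).
rewrite (bigD1 (inord n)) //= big1 ?addr0 => [|j jn].
  by rewrite !mxE !inordK // ?eqxx ?scale1r // ltnW.
rewrite !mxE inordK // eqSS; case: eqP => [e|]; rewrite ?scale0r //.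
by case/eqP: jn; apply: val_inj; rewrite /= e inord_val.
Qed.

Lemma tcomp_h x n :
  tcomp (sl2h (tens M C) x) n =
  sl2h M (tcomp x n) + (C%:R - 2 * n%:R) *: tcomp x n.
Proof.
rewrite /tcomp; case: leqP => nC; last by rewrite linear0 scaler0 addr0.
rewrite ffunE; congr (_ + _); rewrite (bigD1 (inord n)) //= big1 ?addr0.
  by rewrite !mxE eqxx inordK.
by move=> j jn; rewrite !mxE eq_sym (negbTE jn) scale0r.
Qed.

(** Since f never lowers the index in V_c, it acts through M alone on the first component that may
    be nonzero, and a power of it clears that component. *)
Lemma f_nilpotent_tens : f_nilpotent M -> f_nilpotent (tens M C).
Proof.
move=> fM x.
(* Here [r] counts the last components that may still be nonzero; [C.+1] allows all of them. *)
suff H r y : (forall n, (n + r <= C)%N -> tcomp y n = 0) ->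
    exists m, iter m (sl2f (tens M C)) y = 0.
  by apply: (H C.+1) => n; rewrite addnS ltnNge leq_addl.
elim: r => [|r IH] in y * => yP.
  exists 0%N; apply: tcompP => n; rewrite tcomp0.
  case: (leqP n C) => [nC|/tcomp_gt//].
  by apply: yP; rewrite addn0.
have [m my] := fM (tcomp y (C - r)).
have mP l n : (n + r <= C)%N -> tcomp (iter l (sl2f (tens M C)) y) n =
    if (n == C - r)%N then iter l (sl2f M) (tcomp y (C - r)) else 0.
  elim: l n => [|l IHl] n nr /=.
    by case: eqP => [->//|/eqP nr']; apply: yP; lia.
  case: n => [|n] in nr *.
    by rewrite tcomp_f0 IHl //; case: ifP; rewrite ?linear0.
  rewrite tcomp_fS ?IHl; try lia.
  by case: ifP; case: ifP; rewrite ?linear0 ?addr0 //; lia.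
have [n nr|l /= my'] := IH (iter m (sl2f (tens M C)) y).
  by rewrite mP // my if_same.
by exists (l + m)%N; rewrite iterD.
Qed.

(** The part 1 (x) f raises the index by one with coefficient 1, so the last component travels
    upwards unchanged as long as it stays within V_c. *)
Lemma tcomp_iterf_lead x i l : (forall n, (i < n)%N -> tcomp x n = 0) ->
  (i + l <= C)%N ->
  tcomp (iter l (sl2f (tens M C)) x) (i + l) = tcomp x i.
Proof.
move=> xi; suff H : (i + l <= C)%N ->
  tcomp (iter l (sl2f (tens M C)) x) (i + l) = tcomp x i /\
  forall n, (i + l < n)%N -> tcomp (iter l (sl2f (tens M C)) x) n = 0.
  by case/H.
elim: l => [|l IH] il; first by rewrite addn0.
have [|IH1 IH2] := IH; first by lia.
rewrite addnS /=; split=> [|n iln].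
  by rewrite tcomp_fS ?IH1 ?IH2 ?linear0 ?add0r //; lia.
case: n => // n in iln *; have [nC|Cn] := ltnP n C; last by rewrite tcomp_gt.
by rewrite tcomp_fS // !IH2 ?linear0 ?addr0 //; lia.
Qed.

(** Descending induction on the index: once the component of index n+1 vanishes, component n of e x
    = 0 says that e kills x_n, and the hypothesis on M applies. *)
Lemma top_inj_tens (Z : lmodType F) (top : {linear M -> Z}) x :
  (forall z : M, sl2e M z = 0 -> top z = 0 -> z = 0) ->
  sl2e (tens M C) x = 0 -> (forall n, top (tcomp x n) = 0) -> x = 0.
Proof.
move=> topM ex tx; apply: tcompP => n; rewrite tcomp0.
have [m] := ubnP (C.+1 - n)%N; elim: m n => // m IH n nm.
have [nC|/tcomp_gt//] := leqP n C.
apply: topM (tx n); have := tcomp_e x n.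
by rewrite ex tcomp0 (IH n.+1) ?scaler0 ?addr0 //; lia.
Qed.

End Tensor.

End Modules.

(** * Modules generated by a singular vector, and maps out of them *)

Section CyclicModules.
Variable F : fieldType.
Implicit Types M L : sl2mod F.

(** Spanning by the f^n m, phrased as an induction principle over linear combinations. *)
Definition cyclic M (m : M) :=
  forall P : M -> Prop, P 0 -> (forall a y z, P y -> P z -> P (a *: y + z)) ->
  (forall n, P (iter n (sl2f M) m)) -> forall y, P y.

(** By [e_iterf] and [h_iterf], the action of e and h on the f^n m depends only on the weight, hence
    is the same on both sides. *)
Lemma cyclic_intertwiner M L w (m : M) (x : L) (g : M -> L) :
  cyclic m -> singular w m -> singular w x -> linear g ->
  (forall n, g (iter n (sl2f M) m) = iter n (sl2f L) x) -> intertwiner g.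
Proof.
move=> cm sm sx lg gf; have [g' gE] := linear_packP lg; subst g.
have lin (d : {linear M -> M}) (d' : {linear L -> L}) a y z :
    g' (d y) = d' (g' y) -> g' (d z) = d' (g' z) ->
    g' (d (a *: y + z)) = d' (g' (a *: y + z)).
  by move=> dy dz; rewrite !linearP dy dz.
split=> //; apply: cm; rewrite ?linear0 //; try by move=> a y z; apply: lin.
- move=> [|n]; first by rewrite /= sm.1 linear0 (gf 0%N) sx.1.
  by rewrite (e_iterf n sm) gf (e_iterf n sx) linearZ /= gf.
- by move=> n; rewrite -iterS !gf.
- by move=> n; rewrite (h_iterf n sm.2) gf (h_iterf n sx.2) linearZ /= gf.
Qed.

Lemma cyclic_ext M L (m : M) (g g' : M -> L) : cyclic m ->
  intertwiner g -> intertwiner g' -> g m = g' m -> g =1 g'.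
Proof.
move=> cm ig ig' gm; have [[lg _ _ _] [lg' _ _ _]] := (ig, ig').
have [[h hE] [h' hE']] := (linear_packP lg, linear_packP lg').
apply: cm; first by rewrite hE hE' !linear0.
  by move=> a y z; rewrite hE hE' !linearP /= => -> ->.
by move=> n; rewrite !intertwiner_iterf // gm.
Qed.

Lemma map_tens_intertwiner M L C (g : M -> L) :
  intertwiner g -> intertwiner (map_tens g : tens M C -> tens L C).
Proof.
move=> [lg ge gf gh]; have [g' gE] := linear_packP lg.
have gop (d : M -> M) d' G : (forall z, g (d z) = d' (g z)) ->
    forall x : tens M C, map_tens g (tens_op d G x) = tens_op d' G (map_tens g x).
  move=> gd x; apply/ffunP=> i; rewrite !ffunE gE linearD -gE gd; congr (_ + _).
  rewrite gE linear_sum; apply: eq_bigr => j _ /=.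
  by rewrite linearZ /= -gE ffunE.
split; [|exact: gop..].
by move=> a x y; apply/ffunP=> i; rewrite !ffunE lg.
Qed.

(** * The irreducible modules and the Verma modules *)

Lemma tcomp_e_irr N (x : irr F N) n :
  tcomp (sl2e (irr F N) x) n = (n.+1 * (N - n))%:R *: tcomp x n.+1 :> F^o.
Proof. by rewrite (tcomp_e (M := triv F)) add0r. Qed.

Lemma tcomp_f_irr0 N (x : irr F N) : tcomp (sl2f (irr F N) x) 0 = 0 :> F^o.
Proof. exact: (tcomp_f0 (M := triv F)). Qed.

Lemma tcomp_f_irrS N (x : irr F N) n : (n < N)%N ->
  tcomp (sl2f (irr F N) x) n.+1 = tcomp x n :> F^o.
Proof. by move=> nN; rewrite (tcomp_fS (M := triv F)) // add0r. Qed.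

Lemma tcomp_h_irr N (x : irr F N) n :
  tcomp (sl2h (irr F N) x) n = (N%:R - 2 * n%:R) *: tcomp x n :> F^o.
Proof. by rewrite (tcomp_h (M := triv F)) add0r. Qed.

Lemma tcomp_vv N n m :
  tcomp (vv F N n) m = ((m == n) && (m <= N)%N)%:R :> F^o.
Proof.
elim: n m => [|n IH] m.
  rewrite /tcomp; case: leqP => mN; last by rewrite andbF.
  by rewrite ffunE -(inj_eq val_inj) /= inordK // andbT.
case: m => [|m]; first exact: tcomp_f_irr0.
have [mN|Nm] := ltnP m N; last by rewrite tcomp_gt // andbF.
by rewrite tcomp_f_irrS // IH eqSS (ltnW mN).
Qed.

Lemma vvE N n i : vv F N n i = (i == n :> nat)%:R :> F.
Proof.
by rewrite -(tcomp_ord (V := F^o)) tcomp_vv -ltnS ltn_ord andbT.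
Qed.

Lemma vv_gt N n : (N < n)%N -> vv F N n = 0.
Proof.
move=> Nn; apply/ffunP=> i; rewrite vvE ffunE; case: eqP => // ni.
by have := ltn_ord i; lia.
Qed.

Lemma irr_sum N (x : irr F N) : x = \sum_(i < N.+1) (x i : F) *: vv F N i.
Proof.
apply/ffunP=> i; rewrite sum_ffunE (bigD1 i) //= big1 => [|j ji].
  by rewrite ffunE vvE eqxx addr0 [RHS]mulr1.
by rewrite ffunE vvE eq_sym (inj_eq val_inj) (negbTE ji) [LHS]mulr0.
Qed.

Lemma cyclic_irr N : cyclic (hwv F N).
Proof.
move=> P P0 PD Pf y; rewrite (irr_sum y); apply: big_ind => // [z t Pz Pt|i _].
  by rewrite -(scale1r z); apply: PD.
by rewrite -[_ *: _]addr0; apply: PD => //; apply: Pf.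
Qed.

Lemma singular_hwv N : singular N%:R (hwv F N).
Proof.
have tn n : tcomp (hwv F N) n = (n == 0%N)%:R :> F^o.
  by rewrite (tcomp_vv N 0); case: n.
split; apply: tcompP => n.
  by rewrite tcomp_e_irr tn scaler0 tcomp0.
rewrite tcomp_h_irr (tcompZ (V := F^o)) tn; case: n => [|n].
  by rewrite mulr0 subr0.
by rewrite !scaler0.
Qed.

Lemma f_nilpotent_irr N : f_nilpotent (irr F N).
Proof. by apply: f_nilpotent_tens => x; exists 1%N. Qed.

Lemma irr_top_linear B : linear (@irr_top F B).
Proof. by move=> a x y; rewrite /irr_top !ffunE. Qed.
HB.instance Definition _ B :=
  GRing.isLinear.Build F (irr F B) (triv F) _ (@irr_top F B) (@irr_top_linear B).

Lemma irr_topE B (x : irr F B) : irr_top x = tcomp x 0 :> F^o.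
Proof. by rewrite /irr_top -(tcomp_ord (V := F^o)). Qed.

Lemma irr_top_f B (x : irr F B) : irr_top (sl2f (irr F B) x) = 0.
Proof. by rewrite irr_topE tcomp_f_irr0. Qed.

Lemma verma_top_linear (lam : F) : linear (@verma_top F lam).
Proof. by move=> a p q; rewrite /Defs.verma_top coefD coefZ. Qed.
HB.instance Definition _ lam :=
  GRing.isLinear.Build F (verma lam) (triv F) _ (@verma_top F lam)
    (@verma_top_linear lam).

Lemma verma_top_f (lam : F) (x : verma lam) : verma_top (sl2f (verma lam) x) = 0.
Proof. by rewrite /Defs.verma_top /= /verma_f coefXM. Qed.

Lemma iterf_verma (lam : F) n :
  iter n (sl2f (verma lam)) (verma_hwv lam) = 'X^n :> {poly F}.
Proof. by elim: n => //= n ->; rewrite /verma_f exprS. Qed.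

Lemma cyclic_verma (lam : F) : cyclic (verma_hwv lam : verma lam).
Proof.
move=> P P0 PD Pf y; rewrite -[y](coefK y) poly_def.
apply: (big_ind P) => // [z t Pz Pt|i _].
  by rewrite -(scale1r z); apply: PD.
by rewrite -[_ *: _]addr0; apply: PD => //; rewrite -(iterf_verma lam).
Qed.

Lemma singular_verma_hwv (lam : F) : singular (2 * lam) (verma_hwv lam : verma lam).
Proof.
split; rewrite /= /verma_e /verma_h /verma_hwv derivC.
  by rewrite -polyC0 derivC polyC0 mulr0 subr0 scaler0.
by rewrite mulr0 scaler0 subr0.
Qed.

Lemma verma_universal (lam : F) L (x : L) : singular (2 * lam) x ->
  exists2 g : verma lam -> L, intertwiner g & g (verma_hwv lam) = x.
Proof.
move=> sx; pose z n := iter n (sl2f L) x.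
pose g (p : verma lam) := \sum_(i < size (p : {poly F})) p`_i *: z i.
(* Frees the range of summation from the degree, so that sums for different polynomials can be added
   over a common range. *)
have gE n (p : {poly F}) : (size p <= n)%N -> g p = \sum_(i < n) p`_i *: z i.
  move=> pn; rewrite /g (big_ord_widen _ (fun i => p`_i *: z i) pn) big_mkcond.
  by apply: eq_bigr => i _; case: ltnP => // /(nth_default 0) ->; rewrite scale0r.
have gX n : g 'X^n = z n.
  rewrite /g size_polyXn big_ord_recr /= coefXn eqxx scale1r big1 ?add0r // => i _.
  by rewrite coefXn; have := ltn_ord i; case: eqP => [->|_ _];
    rewrite ?ltnn ?scale0r.
have lg : linear g.
  move=> a p q; pose n := maxn (size (a *: p + q : {poly F}))
    (maxn (size (p : {poly F})) (size (q : {poly F}))).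
  rewrite !(gE n) ?leq_max ?leqnn ?orbT // scaler_sumr -big_split.
  by apply: eq_bigr => i _ /=; rewrite coefD coefZ scalerDl scalerA.
exists g; last by have := gX 0%N; rewrite expr0.
apply: (cyclic_intertwiner (@cyclic_verma lam) (singular_verma_hwv lam) sx lg).
by move=> n; rewrite iterf_verma gX.
Qed.

Lemma irr_universal A M (x : M) : singular A%:R x ->
  iter A.+1 (sl2f M) x = 0 ->
  exists2 g : irr F A -> M, intertwiner g & g (hwv F A) = x.
Proof.
move=> sx fx; pose g (v : irr F A) := \sum_(i < A.+1) (v i : F) *: iter i (sl2f M) x.
have gv n : g (vv F A n) = iter n (sl2f M) x.
  have [nA|An] := leqP n A; last first.
    rewrite vv_gt // -(subnK An) iterD fx iterf0 /g big1 // => i _.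
    by rewrite ffunE scale0r.
  rewrite /g (bigD1 (Ordinal (nA : (n < A.+1)%N))) //= big1 => [|i ni].
    by rewrite vvE eqxx scale1r addr0.
  by rewrite vvE -(inj_eq val_inj) /= in ni *; rewrite (negbTE ni) scale0r.
exists g; last exact: (gv 0%N).
apply: (cyclic_intertwiner (@cyclic_irr A) (singular_hwv A) sx) => // a y t.
rewrite /g scaler_sumr -big_split; apply: eq_bigr => i _ /=.
by rewrite !ffunE scalerDl scalerA.
Qed.

Lemma map_tens_linear M L C (g : {linear M -> L}) :
  linear (map_tens g : tens M C -> tens L C).
Proof. by move=> a x y; apply/ffunP=> i; rewrite !ffunE linearP. Qed.
HB.instance Definition _ M L C (g : {linear M -> L}) :=
  GRing.isLinear.Build F (tens M C) (tens L C) _ (map_tens g)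
    (@map_tens_linear M L C g).

Lemma tcomp_map_tens M L C (g : {linear M -> L}) (x : tens M C) n :
  tcomp (map_tens g x) n = g (tcomp x n).
Proof. exact: tcomp_map. Qed.

(* Taking the top coefficient commutes with f, although not with e and h. *)
Lemma map_top_iterf M C (top : {linear M -> triv F}) n (x : tens M C) :
  (forall z, top (sl2f M z) = 0) ->
  map_tens top (iter n (sl2f (tens M C)) x) =
    iter n (sl2f (irr F C)) (map_tens top x).
Proof.
move=> topf; elim: n => //= n <-; move: (iter n _ x) => {}x.
apply/ffunP=> i; rewrite !ffunE linearD topf; congr (_ + _).
by rewrite linear_sum; apply: eq_bigr => j _ /=; rewrite linearZ ffunE.
Qed.

Lemma coef_verma_e (lam : F) (p : {poly F}) n :
  (verma_e lam p)`_n = (2 * lam - n%:R) * n.+1%:R * p`_n.+1.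
Proof.
rewrite /verma_e coefB coefZ coefXM !coef_deriv.
case: n => [|n] /=; first by rewrite !mulr1 subr0 subr0.
by ring.
Qed.

Section CharZero.
Hypothesis F0 : [pchar F] =i pred0.

Lemma irr_singular_top N (y : irr F N) :
  sl2e (irr F N) y = 0 -> irr_top y = 0 -> y = 0.
Proof.
move=> ey ty; apply: tcompP => -[|n]; first by rewrite -irr_topE ty tcomp0.
rewrite tcomp0; have [nN|Nn] := ltnP n N; last by rewrite tcomp_gt.
have /eqP := tcomp_e_irr y n; rewrite ey tcomp0 eq_sym scaler_eq0 natrM mulf_eq0.
by rewrite -(subnSK nN) !(negbTE (natrS_neq0 F0 _)) => /eqP.
Qed.

(** The coefficient by which e passes from degree n+1 to degree n is (2 mu - n)(n+1), which
    genericity keeps nonzero. *)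
Lemma verma_singular_top (mu : F) (y : verma mu) : generic mu ->
  sl2e (verma mu) y = 0 -> verma_top y = 0 -> y = 0.
Proof.
move=> gmu ey ty; apply/polyP => -[|n]; rewrite coef0 //.
have /eqP := coef_verma_e mu y n; rewrite [verma_e mu y]ey coef0 eq_sym.
rewrite !mulf_eq0 (negbTE (natrS_neq0 F0 _)) orbF => /orP[|/eqP//].
by rewrite subr_eq0 => /eqP e; have := gmu n; rewrite e eqxx.
Qed.

End CharZero.
End CyclicModules.

(** Solution of the recurrence expressing that e kills the vector: with n = q - l - 1, the scalar
    (l+1)(w - l) from e f^(l+1) m must cancel (n+1)(C - n) from V_c. A factor with w = t is zero by
    the convention on division, hence the hypotheses excluding these weights below. *)
Definition sing_coef (F : fieldType) (w : F) (C q l : nat) : F :=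
  \prod_(t < l) - (((q - t) * (C - q + t.+1))%:R / (t.+1%:R * (w - t%:R))).

Lemma sing_coef0 (F : fieldType) (w : F) C q : sing_coef w C q 0 = 1.
Proof. by rewrite /sing_coef big_ord0. Qed.

(** * The explicit singular vectors of M (x) V_c and their uniqueness *)

Section SingularTensor.
Variable F : fieldType.
Implicit Types M L : sl2mod F.

(* For m singular of weight w in M, the singular vector of M (x) V_c with
   coefficient m at v_{c,q}. *)
Definition sing_tens M (C : nat) (w : F) (q : nat) (m : M) : tens M C :=
  [ffun i : 'I_C.+1 =>
     if (i <= q)%N then sing_coef w C q (q - i) *: iter (q - i) (sl2f M) m
     else 0].

Lemma tcomp_sing_tens M C w q (m : M) n : (q <= C)%N ->
  tcomp (sing_tens C w q m) n =
  if (n <= q)%N then sing_coef w C q (q - n) *: iter (q - n) (sl2f M) m else 0.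
Proof.
move=> qC; rewrite (tcomp_ffun _ (fun n : nat => if (n <= q)%N then
  sing_coef w C q (q - n) *: iter (q - n) (sl2f M) m else 0)).
by case: leqP => // Cn; case: leqP => // nq; lia.
Qed.

Lemma map_top_sing_tens M C w q (m : M) (top : {linear M -> triv F}) :
  (forall z, top (sl2f M z) = 0) -> top m = 1 -> (q <= C)%N ->
  map_tens top (sing_tens C w q m) = vv F C q.
Proof.
move=> topf topm qC; apply/ffunP=> i; rewrite vvE !ffunE.
case: (ltngtP i q) => iq; rewrite ?linear0 //.
  by rewrite linearZ -(subnSK iq) /= topf scaler0.
by rewrite iq subnn sing_coef0 scale1r.
Qed.

(* The tensor product of the top coefficients of g (x) 1 is computed from that
   of g alone because top' kills the image of f. *)
Lemma map_map_top_sing_tens M L B C w p q (m : M) (g : M -> tens L B)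
    (top' : {linear L -> triv F}) :
  intertwiner g -> (forall z, top' (sl2f L z) = 0) ->
  map_tens top' (g m) = vv F B p ->
  map_tens (map_tens top') (map_tens g (sing_tens C w q m)) =
  sing_tens C w q (vv F B p).
Proof.
move=> ig topf gm; have [lg _ _ _] := ig; have [g' gE] := linear_packP lg.
apply/ffunP=> i; rewrite !ffunE; case: ifP => _; last first.
  by rewrite gE linear0; apply/ffunP=> j; rewrite !ffunE linear0.
rewrite -gm -map_top_iterf // -intertwiner_iterf // gE linearZ.
by apply/ffunP=> j; rewrite !ffunE linearZ.
Qed.

Lemma iterf_vv B p n : iter n (sl2f (irr F B)) (vv F B p) = vv F B (n + p).
Proof. by rewrite /vv iterD. Qed.

Lemma sing_tens_vvE B C w p q (j : 'I_C.+1) (i : 'I_B.+1) :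
  (sing_tens C w q (vv F B p) j i : F) =
  if (j <= q)%N && (i == (q - j) + p :> nat)%N then sing_coef w C q (q - j)
  else 0.
Proof.
rewrite !ffunE; case: leqP => jq /=; last by rewrite ffunE.
by rewrite iterf_vv ffunE vvE; case: eqP => _; rewrite ?scaler0 // [LHS]mulr1.
Qed.

Section CharZero.
Hypothesis F0 : [pchar F] =i pred0.

Lemma singular_sing_tens M C w q (m : M) : singular w m -> (q <= C)%N ->
  (forall t, (t < q)%N -> w != t%:R) ->
  singular (w + C%:R - 2 * q%:R) (sing_tens C w q m).
Proof.
move=> sm qC wt; split; apply: tcompP => n; last first.
  rewrite tcomp_h tcompZ tcomp_sing_tens //; case: leqP => nq; last first.
    by rewrite linear0 !scaler0 addr0.
  rewrite linearZ /= (h_iterf _ sm.2) !scalerA -scalerDl; congr (_ *: _).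
  by rewrite natrB //; ring.
rewrite tcomp_e tcomp0 !tcomp_sing_tens //.
case: (ltngtP n q) => nq; last first.
- by rewrite nq subnn linearZ /= sm.1 !scaler0 addr0.
- by rewrite linear0 scaler0 addr0.
rewrite -(subnSK nq) linearZ [sl2e M _](e_iterf _ sm) /= !scalerA -scalerDl.
rewrite /sing_coef big_ord_recr /=.
set l := (q - n.+1)%N; set c := \prod_(_ < _) _.
have -> : (q - l = n.+1)%N by rewrite /l; lia.
have -> : (C - q + l.+1 = C - n)%N by rewrite /l; lia.
have lw : w - l%:R != 0 by rewrite subr_eq0 wt // /l; lia.
have lS := natrS_neq0 F0 l.
have -> : c * - ((n.+1 * (C - n))%:R / (l.+1%:R * (w - l%:R))) *
    (l.+1%:R * (w - l%:R)) + (n.+1 * (C - n))%:R * c = 0.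
  rewrite mulrN mulNr -mulrA divfK ?mulf_neq0 //; ring.
by rewrite scale0r.
Qed.

(** The difference of the two vectors is killed by e and has no top coefficients, so [top_inj_tens]
    makes it vanish. *)
Lemma sing_tens_unique M C w q (m : M) (top : {linear M -> triv F}) x :
  (forall z, sl2e M z = 0 -> top z = 0 -> z = 0) ->
  (forall z, top (sl2f M z) = 0) -> top m = 1 -> singular w m ->
  (q <= C)%N -> (forall t, (t < q)%N -> w != t%:R) ->
  sl2e (tens M C) x = 0 -> map_tens top x = vv F C q -> x = sing_tens C w q m.
Proof.
move=> top_inj topf topm sm qC wt ex tx; apply/eqP; rewrite -subr_eq0; apply/eqP.
apply: (top_inj_tens top_inj).
  by rewrite linearB /= ex (singular_sing_tens sm qC wt).1 subr0.
move=> n; rewrite -tcomp_map_tens linearB /= tx map_top_sing_tens // subrr.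
by rewrite (tcomp0 C (triv F)).
Qed.

Lemma irr_top_hwv N : irr_top (hwv F N) = 1.
Proof. by rewrite /irr_top ffunE. Qed.

(** * The intertwiners phi and the 6j-symbols *)

Lemma f_nilpotent_tens_irr B C : f_nilpotent (tens (irr F B) C).
Proof. by apply: f_nilpotent_tens; apply: f_nilpotent_irr. Qed.

Lemma phi_exists A B C : admissible A B C ->
  exists g : irr F A -> tens (irr F B) C, is_phi g.
Proof.
case/and4P=> oddABC AB BA CA; set q := (B + C - A)./2.
have [qB qC] : (q <= B /\ q <= C)%N by rewrite /q; lia.
have wt t : (t < q)%N -> B%:R != t%:R :> F.
  by move=> tq; apply/eqP => /(natr_inj F0); lia.
have := singular_sing_tens (singular_hwv F B) qC wt.
set x := sing_tens _ _ _ _.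
have -> : B%:R + C%:R - 2 * q%:R = A%:R :> F.
  by rewrite -natrM -natrD -natrB; [congr _%:R|]; rewrite /q; lia.
move=> sx; have tx : map_tens (@irr_top F B) x = vv F C q.
  by apply: map_top_sing_tens => //; [exact: irr_top_f|exact: irr_top_hwv].
have x0 : x != 0.
  apply/eqP=> x0; have := tcomp_vv F C q q.
  rewrite -tx x0 linear0 (tcomp0 C (triv F)) eqxx qC => /esym/eqP.
  by rewrite oner_eq0.
have fnil := @f_nilpotent_tens_irr B C.
(* Local nilpotency, with the weight already known to be [A], yields f^(A+1) x = 0, so that x
   extends to a map from V_a. *)
have [n /(natr_inj F0) <- fx] := singular_nat F0 fnil sx x0.
by have [g ig gx] := irr_universal sx fx; exists g; split; rewrite ?gx.
Qed.

Lemma phiP A B C : admissible A B C -> is_phi (phi F A B C).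
Proof. by move=> adm; apply: xgetPex; exact: phi_exists. Qed.

Lemma phi_intertwiner A B C : admissible A B C -> intertwiner (phi F A B C).
Proof. by case/phiP. Qed.

Lemma phi_hwv A B C : admissible A B C ->
  phi F A B C (hwv F A) = sing_tens C B%:R (B + C - A)./2 (hwv F B).
Proof.
move=> adm; have [ig tg] := phiP adm; case/and4P: adm => oddABC AB BA CA.
apply: (@sing_tens_unique (irr F B) _ _ _ _ (@irr_top F B)) tg.
- exact: irr_singular_top.
- exact: irr_top_f.
- exact: irr_top_hwv.
- exact: singular_hwv.
- by lia.
- by move=> t tq; apply/eqP => /(natr_inj F0); lia.
by have [] := singular_intertwiner ig (singular_hwv F A).
Qed.

(** By weight, only one top coefficient of y, at index i with A + B = N + 2i, can be nonzero; so y
    has the top coefficients of a multiple of phi_n v_n and equals it. *)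
Lemma singular_irr_tens A B N (y : tens (irr F A) B) : singular N%:R y ->
  y != 0 -> admissible N A B /\ exists a, y = a *: phi F N A B (hwv F N).
Proof.
move=> sy y0; have fnil := @f_nilpotent_tens_irr A B.
have [n /(natr_inj F0) eN fy] := singular_nat F0 fnil sy y0; subst n.
pose ty := map_tens (@irr_top F A) y.
have tyE i : tcomp ty i = irr_top (tcomp y i) by rewrite tcomp_map_tens.
have wt i : tcomp ty i != 0 -> (A + B = N + 2 * i)%N /\ (i <= B)%N.
  move=> tyi; split; last first.
    by case: leqP tyi => // /(tcomp_gt ty) ->; rewrite eqxx.
  apply: (natr_inj F0); rewrite natrD [RHS]natrD natrM.
  have := congr1 (fun z => irr_top (tcomp z i)) sy.2.
  rewrite tcomp_h tcompZ linearD !linearZ /= -!tyE irr_topE tcomp_h_irr.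
  rewrite -irr_topE -tyE mulr0 subr0 -scalerDl => /eqP.
  rewrite -subr_eq0 -scalerBl scaler_eq0 (negbTE tyi) orbF subr_eq0 => /eqP <-.
  by ring.
have [i tyi] : exists i, tcomp ty i != 0.
  apply/notP => H; case/eqP: y0.
  apply: (top_inj_tens (top := @irr_top F A) _ sy.1); first exact: irr_singular_top.
  move=> n; apply/eqP; apply/negPn/negP; rewrite /= -tyE => ?; by apply: H; exists n.
have [ei iB] := wt i tyi; pose a : F := tcomp ty i.
have tyv : ty = a *: vv F B i.
  apply: tcompP => n; rewrite (tcompZ (V := F^o)) tcomp_vv.
  have [->|ni] /= := eqVneq n i; first by rewrite iB [RHS]mulr1.
  rewrite [RHS]mulr0; apply/eqP/negPn/negP => /wt [en _]; case/eqP: ni; lia.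
(* The remaining triangle inequality: f^(N+1) y = 0 sends the top coefficient v_{b,i} to zero, so
   its index must leave V_b. *)
have iN : (B < i + N.+1)%N.
  have := congr1 (map_tens (@irr_top F A)) fy.
  rewrite map_top_iterf -/ty ?tyv; last exact: irr_top_f.
  rewrite iterfZ iterf_vv => e; rewrite ltnNge; apply/negP => iNB.
  have := tcompZ (V := F^o) a (vv F B (N.+1 + i)) (N.+1 + i).
  rewrite e linear0 (tcomp0 B (triv F)) tcomp_vv eqxx addnC iNB => /esym/eqP.
  by rewrite scaler_eq0 oner_eq0 orbF (negbTE tyi).
have adm : admissible N A B by rewrite /admissible; lia.
split=> //; exists a; have [ig tg] := phiP adm.
apply/eqP; rewrite -subr_eq0; apply/eqP.
have [ep _] := singular_intertwiner ig (singular_hwv F N).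
apply: (top_inj_tens (top := @irr_top F A)); first exact: irr_singular_top.
  by rewrite linearB linearZ /= sy.1 ep scaler0 subr0.
move=> n; rewrite -tcomp_map_tens linearB linearZ /= tg -/ty tyv.
rewrite [(_ - _)./2](_ : _ = i) ?subrr ?(tcomp0 B (triv F)) //; lia.
Qed.

End CharZero.
End SingularTensor.

(** * Existence of the 6j-symbols and the top coefficient of their defining relation *)

Section SixJ.
Variable F : fieldType.
Hypothesis F0 : [pchar F] =i pred0.
Implicit Types M L : sl2mod F.

(** Only terms with nonzero coefficient are constrained, because [phi] is known to be an intertwiner
    only for admissible spins. *)
Lemma intertwiner_sum M L n (X : 'I_n -> F) (g : 'I_n -> M -> L) :
  (forall i, X i != 0 -> intertwiner (g i)) ->
  intertwiner (fun x => \sum_i X i *: g i x).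
Proof.
move=> ig; have op (d : {linear M -> M}) (d' : {linear L -> L}) x :
    (forall i, X i != 0 -> g i (d x) = d' (g i x)) ->
    \sum_i X i *: g i (d x) = d' (\sum_i X i *: g i x).
  move=> gd; rewrite linear_sum; apply: eq_bigr => i _; rewrite linearZ /=.
  by have [->|/gd ->] := eqVneq (X i) 0; rewrite ?scale0r.
split=> [a x y|x|x|x].
- rewrite scaler_sumr -big_split; apply: eq_bigr => i _ /=.
  have [->|/ig [lg _ _ _]] := eqVneq (X i) 0.
    by rewrite !scale0r scaler0 addr0.
  by rewrite lg scalerDr !scalerA mulrC.
- by apply: op => i /ig [].
- by apply: op => i /ig [].
- by apply: op => i /ig [].
Qed.

Lemma tens_map_intertwiner M J B C (g : irr F J -> tens (irr F B) C) :
  intertwiner g ->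
  intertwiner (tens_map g : tens M J -> tens (tens M B) C).
Proof.
move=> [lg ge gf gh]; have [g' gE] := linear_packP lg.
have op (d : {linear M -> M}) EJ EB EC :
    (forall v : irr F J, g (tens_op (M := triv F) (@triv0 F) EJ v) =
       tens_op (M := irr F B) (tens_op (M := triv F) (@triv0 F) EB) EC (g v)) ->
    forall x : tens M J,
      tens_map g (tens_op d EJ x) =
      tens_op (M := tens M B) (tens_op d EB) EC (tens_map g x).
  move=> gd x; apply/ffunP=> q; apply/ffunP=> p; rewrite !ffunE sum_ffunE.
  pose G i q p : F := g (vv F J i) q p.
  rewrite linear_sum -addrA.
  under eq_bigr do rewrite ffunE scalerDr.
  rewrite big_split; congr (_ + _).
    by apply: eq_bigr => i _ /=; rewrite linearZ.
  under eq_bigr do rewrite scaler_sumr.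
  rewrite exchange_big.
  under [X in _ = X + _]eq_bigr do rewrite ffunE scaler_sumr.
  under [X in _ = _ + X]eq_bigr do rewrite !ffunE scaler_sumr.
  rewrite [X in _ = X + _]exchange_big [X in _ = _ + X]exchange_big -big_split.
  apply: eq_bigr => j _ /=.
  under eq_bigr do rewrite scalerA.
  under [X in _ = X + _]eq_bigr do rewrite scalerA.
  under [X in _ = _ + X]eq_bigr do rewrite scalerA.
  rewrite -!scaler_suml -scalerDl; congr (_ *: _).
  (* What remains is the coefficient of x_j: the compatibility of g at v_j, with the image of v_j
     expanded in the basis of V_j. *)
  have := gd (vv F J j); rewrite [tens_op _ _ _]irr_sum gE linear_sum -gE.
  move=> /(congr1 (fun z : {ffun _ -> {ffun _ -> F^o}} => z q p)).
  rewrite !ffunE !sum_ffunE add0r => e; apply: etrans (etrans e _); last first.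
    by congr (_ + _); apply: eq_bigr => i _; rewrite ffunE.
  apply: eq_bigr => i _; rewrite gE linearZ -gE !ffunE mulrC; congr (_ * _).
  rewrite add0r (bigD1 j) //= big1 => [|k kj]; rewrite vvE.
    by rewrite eqxx addr0 [RHS]mulr1.
  by rewrite (inj_eq val_inj) (negbTE kj) [LHS]mulr0.
split.
2: exact: (op (sl2e M) (irr_e F J) (irr_e F B) (irr_e F C) ge).
2: exact: (op (sl2f M) (irr_f F J) (irr_f F B) (irr_f F C) gf).
2: exact: (op (sl2h M) (irr_h F J) (irr_h F B) (irr_h F C) gh).
move=> a x y; apply/ffunP=> q; apply/ffunP=> p; rewrite !ffunE scaler_sumr.
rewrite -big_split; apply: eq_bigr => i _ /=.
by rewrite !ffunE scalerDr !scalerA mulrC.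
Qed.

Lemma map_top_tens_map A J B C (g : irr F J -> tens (irr F B) C)
    (x : tens (irr F A) J) : linear g ->
  map_tens (map_tens (@irr_top F A)) (tens_map g x) =
  g (map_tens (@irr_top F A) x).
Proof.
move=> lg; have [g' gE] := linear_packP lg.
apply/ffunP=> q; apply/ffunP=> p.
rewrite [map_tens _ x in RHS]irr_sum gE linear_sum sum_ffunE sum_ffunE -gE !ffunE.
rewrite linear_sum; apply: eq_bigr => i _.
by rewrite linearZ gE linearZ -gE !ffunE [LHS]mulrC.
Qed.

Lemma sixj_basis_intertwiner A B C K N : admissible N A B -> admissible K N C ->
  intertwiner (map_tens (phi F N A B) \o phi F K N C :
    irr F K -> tens (tens (irr F A) B) C).
Proof.
move=> admN admK; apply: intertwiner_comp (phi_intertwiner F0 admK) _.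
exact/map_tens_intertwiner/phi_intertwiner.
Qed.

(* The component of x of largest index r is singular in V_a (x) V_b, hence a
   multiple of phi_n v_n; since f^(2k+1) x = 0 this n is coupled to c and k, and
   subtracting the corresponding basis vector decreases r. *)
Lemma singular_irr_tens2 A B C K (x : tens (tens (irr F A) B) C) :
  singular K%:R x ->
  exists2 X : nat -> F,
    forall N, ~~ (admissible N A B && admissible K N C) -> X N = 0 &
    x = \sum_(N < (A + B).+1)
          X N *: map_tens (phi F N A B) (phi F K N C (hwv F K)).
Proof.
have [r] : exists r, forall n, (r <= n)%N -> tcomp x n = 0.
  by exists C.+1 => n; apply: tcomp_gt.
elim: r x => [|r IH] x xr sx.
  exists (fun=> 0) => //; rewrite big1 => [|N _]; last by rewrite scale0r.
  by apply: tcompP => n; rewrite xr // tcomp0.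
have [xr0|xr0] := eqVneq (tcomp x r) 0.
  by apply: IH => // n; rewrite leq_eqVlt => /orP[/eqP <-|/xr].
have rC : (r <= C)%N by case: leqP xr0 => // /(tcomp_gt x) ->; rewrite eqxx.
have x0 : x != 0 by apply: contraNneq xr0 => ->; rewrite tcomp0.
have fnil : f_nilpotent (tens (tens (irr F A) B) C).
  exact/f_nilpotent_tens/f_nilpotent_tens_irr.
have [n /(natr_inj F0) eK fx] := singular_nat F0 fnil sx x0; subst n.
(* Otherwise the last component would survive f^(K+1). With K + 2r = N + C this becomes the triangle
   inequality C <= K + N. *)
have CrK : (C < r + K.+1)%N.
  rewrite ltnNge; apply/negP=> /(tcomp_iterf_lead (fun n => xr n)) e.
  by move: xr0; rewrite -e fx tcomp0 eqxx.
have sy : singular (K%:R - C%:R + 2 * r%:R) (tcomp x r).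
  split.
    by have := tcomp_e x r; rewrite sx.1 tcomp0 (xr r.+1) // scaler0 addr0.
  have := tcomp_h x r; rewrite sx.2 tcompZ => /esym/(canRL (addrK _)) ->.
  by rewrite -scalerBl; congr (_ *: _); ring.
have [N eN _] := singular_nat F0 (@f_nilpotent_tens_irr _ A B) sy xr0.
rewrite eN in sy; have eKN : (K + 2 * r = N + C)%N.
  by apply: (natr_inj F0); rewrite natrD [RHS]natrD natrM -eN; ring.
have [admN [a xra]] := singular_irr_tens F0 sy xr0.
have admK : admissible K N C.
  by rewrite /admissible; lia.
have NAB : (N < (A + B).+1)%N by case/and4P: admN.
pose S := map_tens (phi F N A B) (phi F K N C (hwv F K)).
have sS : singular K%:R S.
  exact: singular_intertwiner (sixj_basis_intertwiner admN admK) (singular_hwv _ _).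
have [lphi _ _ _] := phi_intertwiner F0 admN.
have [g' gE] := linear_packP lphi.
have tS n : tcomp S n = phi F N A B (tcomp (phi F K N C (hwv F K)) n).
  by rewrite /S gE tcomp_map_tens.
have [||X' X'0 xE] := IH (x - a *: S).
- move=> n rn; rewrite addrC -scaleNr tcomp_linearP tS phi_hwv //.
  rewrite tcomp_sing_tens; last by lia.
  rewrite [(_ - _)./2](_ : _ = r); last by lia.
  move: rn; rewrite leq_eqVlt => /orP[/eqP <-|rn].
    by rewrite leqnn subnn sing_coef0 scale1r xra scaleNr addNr.
  by rewrite leqNgt rn /= xr // gE linear0 scaler0 addr0.
- by rewrite addrC -scaleNr; apply: singular_linear.
exists (fun n => X' n + (n == N)%:R * a) => [n admn|].
  rewrite X'0 //; case: eqP => [eNn|_]; last by rewrite mul0r addr0.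
  by move: admn; rewrite eNn admN admK.
pose v (i : 'I_(A + B).+1) := map_tens (phi F i A B) (phi F K i C (hwv F K)).
rewrite (eq_bigr (fun i : 'I__ => X' i *: v i + (i == N :> nat)%:R * a *: v i)); last first.
  by move=> i _; rewrite -scalerDl.
rewrite -[x in LHS](subrK (a *: S)) big_split; congr (_ + _); first exact: xE.
rewrite (bigD1 (Ordinal NAB)) //= big1 => [|i iN].
  by rewrite eqxx mul1r addr0.
by rewrite -(inj_eq val_inj) /= in iN; rewrite (negbTE iN) mul0r scale0r.
Qed.

(** Both sides are intertwiners on V_k, so the expansion of the image of v_k given by
    [singular_irr_tens2] propagates to the whole module. *)
Lemma is_sixj_exists A B C K J : admissible J B C -> admissible K A J ->
  exists X : nat -> F, is_sixj A B C K J X.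
Proof.
move=> admJ admK; pose T := tens_map (phi F J B C) \o phi F K A J.
have iT : intertwiner (T : irr F K -> tens (tens (irr F A) B) C).
  apply: intertwiner_comp (phi_intertwiner F0 admK) _.
  exact/tens_map_intertwiner/phi_intertwiner.
have [X X0 XE] := singular_irr_tens2 (singular_intertwiner iT (singular_hwv F K)).
pose g (N : 'I_(A + B).+1) : irr F K -> tens (tens (irr F A) B) C :=
  map_tens (phi F N A B) \o phi F K N C.
have iS : intertwiner (fun x => \sum_(N < (A + B).+1) X N *: g N x); last first.
  by exists X; split; [exact: X0|exact: cyclic_ext (@cyclic_irr F K) iT iS XE].
apply: intertwiner_sum => N XN.
have /andP[admN admKN] : admissible N A B && admissible K N C.
  by apply: contraNT XN => /X0 ->.
exact: sixj_basis_intertwiner.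
Qed.

Lemma sixjP A B C K J : admissible J B C -> admissible K A J ->
  is_sixj A B C K J (fun N => sixj F A B N C K J).
Proof.
move=> admJ admK; have /(xgetPex (fun=> 0)) := is_sixj_exists admJ admK.
by rewrite /sixj admJ admK.
Qed.

(* The top coefficient in V_a of the identity defining the 6j-symbols. *)
Lemma sixj_top A B C K J : admissible J B C -> admissible K A J ->
  phi F J B C (vv F J (J + A - K)./2) =
  \sum_(N < (A + B).+1) sixj F A B N C K J *:
    sing_tens C N%:R (C + N - K)./2 (vv F B (B + A - N)./2).
Proof.
move=> admJ admK; have [X0 /(_ (hwv F K))] := sixjP admJ admK.
move=> /(congr1 (map_tens (map_tens (@irr_top F A)))).
have [lphi _ _ _] := phi_intertwiner F0 admJ.
rewrite map_top_tens_map // (phiP F0 admK).2 [(A + J)%N]addnC => ->.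
rewrite linear_sum; apply: eq_bigr => N _; rewrite linearZ /=.
have [admN|/X0 ->] := boolP (admissible N A B && admissible K N C); last first.
  by rewrite !scale0r.
case/andP: admN => admN admKN; rewrite phi_hwv // [(C + N)%N]addnC.
rewrite (map_map_top_sing_tens (top' := @irr_top F A)
  _ _ _ (phi_intertwiner F0 admN) _ (phiP F0 admN).2); last exact: irr_top_f.
by rewrite [(B + A)%N]addnC.
Qed.

End SixJ.

(** * Values of rational functions at points where they are regular *)

Section RationalValues.
Variable F : fieldType.
Implicit Types (r : {fraction {poly F}}) (x y c : F).

Lemma ratval_tofrac (p : {poly F}) x : ratval (tofrac p) x p.[x].
Proof.
by exists p, 1; rewrite hornerC oner_eq0 tofrac1 !divr1.
Qed.

Lemma ratval_cst c x : ratval (ratcst c) x c.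
Proof. by rewrite -[X in ratval _ _ X](hornerC c x); apply: ratval_tofrac. Qed.

Lemma ratval0 x : ratval 0 x 0.
Proof. by have := ratval_tofrac 0 x; rewrite tofrac0 horner0. Qed.

Lemma ratval1 x : ratval 1 x 1.
Proof. by have := ratval_tofrac 1 x; rewrite tofrac1 hornerC. Qed.

Lemma tofrac_neq0 (p : {poly F}) x : p.[x] != 0 -> tofrac p != 0.
Proof.
by apply: contraNneq => /eqP; rewrite tofrac_eq0 => /eqP ->; rewrite horner0.
Qed.

Lemma ratvalD r r' x y y' :
  ratval r x y -> ratval r' x y' -> ratval (r + r') x (y + y').
Proof.
move=> [p [q [q0 -> ->]]] [p' [q' [q'0 -> ->]]].
exists (p * q' + p' * q), (q * q').
rewrite hornerD !hornerM mulf_neq0 //; split=> //.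
  rewrite tofracD !tofracM addf_div //; first exact: tofrac_neq0 q0.
  exact: tofrac_neq0 q'0.
by rewrite addf_div.
Qed.

Lemma ratvalM r r' x y y' :
  ratval r x y -> ratval r' x y' -> ratval (r * r') x (y * y').
Proof.
move=> [p [q [q0 -> ->]]] [p' [q' [q'0 -> ->]]].
exists (p * p'), (q * q'); rewrite !hornerM mulf_neq0 //.
split=> //; first by rewrite !tofracM mulf_div.
by rewrite mulf_div.
Qed.

Lemma ratvalN r x y : ratval r x y -> ratval (- r) x (- y).
Proof.
move=> /(ratvalM (ratval_cst (-1) x)).
by rewrite /ratcst polyCN tofracN tofrac1 !mulN1r.
Qed.

Lemma ratvalV r x y : y != 0 -> ratval r x y -> ratval r^-1 x y^-1.
Proof.
move=> y0 [p [q [q0 -> yE]]]; exists q, p; rewrite yE !invf_div; split=> //.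
by apply: contraNneq y0 => p0; rewrite yE p0 mul0r.
Qed.

Lemma ratval_sum n (r : 'I_n -> {fraction {poly F}}) x (y : 'I_n -> F) :
  (forall i, ratval (r i) x (y i)) -> ratval (\sum_i r i) x (\sum_i y i).
Proof.
move=> ry; elim/big_ind2: _ => // [|? ? ? ?]; [exact: ratval0|exact: ratvalD].
Qed.

Lemma ratval_prod n (r : 'I_n -> {fraction {poly F}}) x (y : 'I_n -> F) :
  (forall i, ratval (r i) x (y i)) -> ratval (\prod_i r i) x (\prod_i y i).
Proof.
move=> ry; elim/big_ind2: _ => // [|? ? ? ?]; [exact: ratval1|exact: ratvalM].
Qed.

Lemma ratval0_unique x y : ratval 0 x y -> y = 0.
Proof.
move=> [p [q [q0 /esym/eqP + ->]]].
rewrite mulf_eq0 invr_eq0 (negbTE (tofrac_neq0 q0)) orbF tofrac_eq0 => /eqP ->.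
by rewrite horner0 mul0r.
Qed.

(** Subtraction reduces this to the zero function, every numerator of which is the zero
    polynomial. *)
Lemma ratval_unique r x y y' : ratval r x y -> ratval r x y' -> y = y'.
Proof.
move=> ry /ratvalN /(ratvalD ry); rewrite subrr => /ratval0_unique/eqP.
by rewrite subr_eq0 => /eqP.
Qed.

Lemma ratevalE r x y : ratval r x y -> rateval x r = y.
Proof.
move=> ry; have /(xgetPex 0) : exists y, ratval r x y by exists y.
by move=> /ratval_unique; apply.
Qed.

Lemma ratval_rateval r x : regular_at r x -> ratval r x (rateval x r).
Proof. by move=> [y ry]; rewrite (ratevalE ry). Qed.

Lemma ratval_sing_coef (w : {poly F}) C q l x :
  [pchar F] =i pred0 -> (forall t, (t < l)%N -> w.[x] != t%:R) ->
  ratval (sing_coef (tofrac w) C q l) x (sing_coef w.[x] C q l).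
Proof.
move=> F0 wt; apply: ratval_prod => t; apply: ratvalN.
have nat_val n : ratval n%:R x n%:R.
  by have := ratval_tofrac n%:R x; rewrite tofracMn tofrac1 -polyC_natr hornerC.
apply: ratvalM => //; apply: ratvalV.
  by rewrite mulf_neq0 ?natrS_neq0 // subr_eq0 wt.
apply: ratvalM => //; apply: ratvalD; first exact: ratval_tofrac.
exact: ratvalN.
Qed.

Section CharZero.
Hypothesis F0 : [pchar F] =i pred0.

(** An infinite supply of generic points: integrality of 2/3 + 2n would give 2 + 6n = 3m, impossible
    modulo 3, and characteristic zero transfers this to [F]. *)
Lemma generic_third n : generic (3^-1 + n%:R : F).
Proof.
move=> m; apply/eqP => e.
have n3 : 3 != 0 :> F by exact: (natrS_neq0 F0 2).
have : (2 + 6 * n%:Z)%:~R = (3 * m)%:~R :> F.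
  by rewrite rmorphD !rmorphM /= -e -pmulrn; field.
move=> /eqP; rewrite -subr_eq0 -rmorphB /=; set z : int := _ - _.
have : z != 0 by rewrite /z; lia.
case: z => k z0; last first.
  by rewrite NegzE rmorphN oppr_eq0 /= -pmulrn (negbTE (natrS_neq0 F0 _)).
by rewrite -pmulrn ((pcharf0P F).1 F0) => /eqP k0; rewrite k0 in z0.
Qed.

Lemma ratval_generic_eq r r' :
  (forall lam, generic lam -> exists2 y, ratval r lam y & ratval r' lam y) ->
  r = r'.
Proof.
move=> rr'; have d0 lam : generic lam -> ratval (r - r') lam 0.
  by move=> /rr' [y ry /ratvalN ry']; rewrite -(subrr y); apply: ratvalD.
have [n [d [dx rE _]]] := d0 _ (generic_third 0).
suff n0 : n = 0 by apply/eqP; rewrite -subr_eq0 rE n0 tofrac0 mul0r.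
(* The numerator is shown to vanish at [size n] distinct points, more than its degree allows. *)
apply: contraTeq isT => n0; pose s := [seq 3^-1 + i%:R : F | i <- iota 0 (size n)].
suff : (size s < size n)%N by rewrite size_map size_iota ltnn.
apply: max_poly_roots => //; last first.
  by rewrite map_inj_uniq ?iota_uniq // => i j /addrI /(natr_inj F0).
apply/allP => _ /mapP[i _ ->]; have [p [q [q0 e]]] := d0 _ (generic_third i).
move=> /esym/eqP; rewrite mulf_eq0 invr_eq0 (negbTE q0) orbF => p0.
(* The value at each point may be witnessed by a different fraction, so the two fractions are
   compared by cross-multiplication. *)
move: e; rewrite rE => /eqP.
rewrite (eqr_div _ _ (tofrac_neq0 dx) (tofrac_neq0 q0)) -!tofracM tofrac_eq.
move=> /eqP/(congr1 (horner^~ (3^-1 + i%:R)))/eqP.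
by rewrite !hornerM (eqP p0) mul0r mulf_eq0 (negbTE q0) orbF.
Qed.

End CharZero.
End RationalValues.

(** * The fusion matrix in closed form *)

Section Fusion.
Variable F : fieldType.

Definition mxvec_unindex m n (s : 'I_(m * n)) : 'I_m * 'I_n :=
  enum_val (cast_ord (esym (mxvec_cast m n)) s).

Lemma mxvec_indexK m n i j :
  mxvec_unindex (@mxvec_index m n i j) = (i, j).
Proof. by rewrite /mxvec_unindex cast_ordK enum_rankK. Qed.

Lemma coordsE B C (u : tens (irr F B) C) p q :
  coords u (mxvec_index p q) ord0 = u q p.
Proof. by rewrite /coords mxE [ord0]ord1 mxvecE mxE. Qed.

Lemma coordsP B C (u v : tens (irr F B) C) : coords u = coords v -> u = v.
Proof.
move=> uv; apply/ffunP=> q; apply/ffunP=> p.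
by rewrite -!coordsE uv.
Qed.

Lemma coords_linear B C : linear (@coords F B C).
Proof.
move=> a x y; apply/colP => s; case/mxvec_indexP: s => p q.
by rewrite !mxE !mxvecE !mxE !ffunE.
Qed.
HB.instance Definition _ B C :=
  GRing.isLinear.Build F (tens (irr F B) C) 'cV[F]_(B.+1 * C.+1) _
    (@coords F B C) (@coords_linear B C).

Lemma coords_vv B C (p : 'I_B.+1) (q : 'I_C.+1) :
  coords (tensv (vv F B p) (vv F C q)) = delta_mx (mxvec_index p q) 0.
Proof.
apply/colP => s; case/mxvec_indexP: s => p' q'.
rewrite coordsE !ffunE !vvE [LHS]mulrC mxE andbT.
have -> : (mxvec_index p' q' == mxvec_index p q) = ((p', q') == (p, q)).
  apply/eqP/eqP => [/(congr1 (@mxvec_unindex _ _))|[-> ->] //].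
  by rewrite !mxvec_indexK.
by rewrite -natrM mulnb xpair_eqE.
Qed.

(* The entry of J_bc in row v_{b,p'} (x) v_{c,q'} and column v_{b,p} (x) v_{c,q};
   the parameter w is 2 (lam - lv), lv being the spin of v_{c,q}. *)
Definition fusion_coef (K : fieldType) (w : K) (C p q p' q' : nat) : K :=
  if (q' <= q)%N && (p' == (q - q') + p :> nat)%N then sing_coef w C q (q - q')
  else 0.

Definition fusion_wt (C q : nat) : {poly F} :=
  2 *: 'X + (2 * q%:R - C%:R)%:P.

Definition fusion_mx (B C : nat) : 'M[{fraction {poly F}}]_(B.+1 * C.+1) :=
  \matrix_(s, t) fusion_coef (tofrac (fusion_wt C (mxvec_unindex t).2)) C
    (mxvec_unindex t).1 (mxvec_unindex t).2
    (mxvec_unindex s).1 (mxvec_unindex s).2.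

Lemma fusion_mxE B C (p p' : 'I_B.+1) (q q' : 'I_C.+1) :
  fusion_mx B C (mxvec_index p' q') (mxvec_index p q) =
  fusion_coef (tofrac (fusion_wt C q)) C p q p' q'.
Proof. by rewrite mxE !mxvec_indexK. Qed.

Lemma coords_sing_tens B C w p (q : 'I_C.+1) p' q' :
  coords (sing_tens C w q (vv F B p)) (mxvec_index p' q') ord0 =
  fusion_coef w C p q p' q'.
Proof. by rewrite coordsE sing_tens_vvE. Qed.

Section CharZero.
Hypothesis F0 : [pchar F] =i pred0.

Lemma two_neq0 : 2 != 0 :> F.
Proof. exact: (natrS_neq0 F0 1). Qed.

Lemma horner_fusion_wt C q x :
  (fusion_wt C q).[x] = 2 * (x - (C%:R / 2 - q%:R)).
Proof. by rewrite hornerD hornerZ hornerX hornerC; field; exact: two_neq0. Qed.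

(** The column of v_{c,q} can have poles only at the weights t < q; this covers generic spins and
    also the integral weights met at lam = k. *)
Lemma ratval_fusion_mx B C (p : 'I_B.+1) (q : 'I_C.+1) x s :
  let w := (fusion_wt C q).[x] in (forall t, (t < q)%N -> w != t%:R) ->
  ratval (fusion_mx B C s (mxvec_index p q)) x
    (coords (sing_tens C w q (vv F B p)) s ord0).
Proof.
case/mxvec_indexP: s => p' q' w wt; rewrite fusion_mxE coords_sing_tens.
rewrite /fusion_coef; case: ifP => _; last exact: ratval0.
by apply: ratval_sing_coef => // t tq; apply: wt; lia.
Qed.

Lemma generic_wt (lam : F) (C q : nat) : generic lam ->
  generic (lam - (C%:R / 2 - q%:R)).
Proof.
move=> glam m; apply/eqP=> e; have /eqP := glam (m + C%:Z - 2 * q%:Z); apply.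
rewrite rmorphB rmorphD rmorphM /= -e -!pmulrn; field; exact: two_neq0.
Qed.

Lemma generic_neq (mu : F) t : generic mu -> 2 * mu != t%:R.
Proof. by move=> /(_ t%:Z); rewrite -pmulrn. Qed.

Lemma Phi_hwv (lam mu : F) C (q : 'I_C.+1) (g : verma lam -> tens (verma mu) C) :
  generic mu -> is_Phi (map_tens (@verma_top F mu)) (vv F C q) g ->
  g (verma_hwv lam) = sing_tens C (2 * mu) q (verma_hwv mu).
Proof.
move=> gmu [ig tg].
apply: (@sing_tens_unique _ F0 (verma mu) _ _ _ _ (@verma_top F mu)) tg.
- by move=> z; apply: verma_singular_top.
- exact: verma_top_f.
- by rewrite /= /Defs.verma_top /verma_hwv coef1.
- exact: singular_verma_hwv.
- by rewrite -ltnS.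
- by move=> t _; apply: generic_neq.
by have [] := singular_intertwiner ig (singular_verma_hwv lam).
Qed.

Lemma Phi_exists (lam mu : F) C (q : 'I_C.+1) :
  generic mu -> mu = lam - (C%:R / 2 - q%:R) ->
  exists g : verma lam -> tens (verma mu) C,
    is_Phi (map_tens (@verma_top F mu)) (vv F C q) g.
Proof.
move=> gmu muE; have qC : (q <= C)%N by rewrite -ltnS.
have := singular_sing_tens F0 (singular_verma_hwv mu) qC
  (fun t _ => generic_neq t gmu).
have -> : 2 * mu + C%:R - 2 * q%:R = 2 * lam.
  by rewrite muE mulrBr mulrBr mulrCA mulfV ?two_neq0 //; ring.
move=> /verma_universal [g ig gE]; exists g; split=> //; rewrite gE.
apply: (@map_top_sing_tens _ (verma mu) _ _ _ _ (@verma_top F mu)) => //.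
  exact: verma_top_f.
by rewrite /= /Defs.verma_top /verma_hwv coef1.
Qed.

(** The inner intertwiner sends v_lam to an explicit combination of the f^n v_mu (x) V_c, and the
    top coefficient of the outer one turns each f^n v_mu into f^n v_{b,p}. *)
Lemma Phi_comp (lam mu nu : F) B C (p : 'I_B.+1) (q : 'I_C.+1)
    (gv : verma lam -> tens (verma mu) C) (gw : verma mu -> tens (verma nu) B) :
  generic mu ->
  is_Phi (map_tens (@verma_top F mu)) (vv F C q) gv ->
  is_Phi (map_tens (@verma_top F nu)) (vv F B p) gw ->
  is_Phi (map_tens (map_tens (@verma_top F nu)))
    (sing_tens C (2 * mu) q (vv F B p)) (map_tens gw \o gv).
Proof.
move=> gmu Pv [iw tw]; split.
  by apply: intertwiner_comp Pv.1 _; apply: map_tens_intertwiner.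
rewrite /= (Phi_hwv gmu Pv).
exact: (map_map_top_sing_tens (top' := @verma_top F nu)
  _ _ _ iw (@verma_top_f F nu) tw).
Qed.

Lemma map_rateval_fusion_mx B C (p : 'I_B.+1) (q : 'I_C.+1) (lam : F) :
  generic lam ->
  let mu := lam - (C%:R / 2 - q%:R) in
  map_mx (rateval lam) (fusion_mx B C) *m coords (tensv (vv F B p) (vv F C q)) =
  coords (sing_tens C (2 * mu) q (vv F B p)).
Proof.
move=> glam mu; rewrite coords_vv -colE; apply/colP => s; rewrite [LHS]mxE [LHS]mxE.
rewrite -horner_fusion_wt; apply: ratevalE; apply: ratval_fusion_mx => t _.
by rewrite horner_fusion_wt; apply/generic_neq/generic_wt.
Qed.

Lemma is_fusion_fusion_mx B C : is_fusion (fusion_mx B C).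
Proof.
move=> lam glam; split=> [s t|p q lw lv mu nu u gv gw].
  case/mxvec_indexP: t => p q; eexists; apply: ratval_fusion_mx => t _.
  by rewrite horner_fusion_wt; apply/generic_neq/generic_wt.
rewrite map_rateval_fusion_mx // => /coordsP ->.
exact: Phi_comp (generic_wt C q glam).
Qed.

(** [is_fusion] quantifies over given intertwiners, so [Phi_exists] must supply them; they fix the
    values of [J] at all generic spins, hence [J] itself. *)
Lemma is_fusion_unique B C (J : 'M_(B.+1 * C.+1)) :
  is_fusion J -> J = fusion_mx B C.
Proof.
move=> fJ; apply/matrixP=> s t; apply: ratval_generic_eq => // lam glam.
have [regJ PJ] := fJ lam glam.
exists (rateval lam (J s t)); first exact: ratval_rateval.
case/mxvec_indexP: t => p q; have gmu := generic_wt C q glam.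
have gnu := generic_wt B p gmu.
have [gv Pv] := Phi_exists gmu erefl; have [gw Pw] := Phi_exists gnu erefl.
pose u : tens (irr F B) C := [ffun q' => [ffun p' =>
  rateval lam (J (mxvec_index p' q') (mxvec_index p q))]].
have uE : coords u = map_mx (rateval lam) J *m coords (tensv (vv F B p) (vv F C q)).
  rewrite coords_vv -colE; apply/colP => s'; rewrite [RHS]mxE [RHS]mxE.
  by case/mxvec_indexP: s' => p' q'; rewrite coordsE !ffunE.
have [_ uP] := PJ p q u gv gw uE Pv Pw.
have [_] := Phi_comp gmu Pv Pw; rewrite uP => {}uP.
have := congr1 (fun z : 'cV[F]__ => z s ord0) uE.
rewrite coords_vv -colE [in RHS]mxE [in RHS]mxE => <-.
rewrite uP -horner_fusion_wt; apply: ratval_fusion_mx => t _.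
by rewrite horner_fusion_wt; apply: generic_neq.
Qed.

Lemma fusionE B C : fusion F B C = fusion_mx B C.
Proof.
apply: is_fusion_unique; apply: xgetPex.
by exists (fusion_mx B C); apply: is_fusion_fusion_mx.
Qed.

(* J_bc is unitriangular for the order on the index of v_{b,p}. *)
Lemma fusion_mx_unit B C : fusion_mx B C \in unitmx.
Proof.
rewrite -unitmx_tr -row_free_unit; apply: inj_row_free => v /rowP vJ.
apply/rowP => s; case/mxvec_indexP: s => p q; rewrite mxE.
(* Because of the transposition, the equation at (p, q) involves besides its own unknown only
   unknowns with smaller p. *)
have [m] := ubnP p; elim: m p q => // m IH p q pm.
have := vJ (mxvec_index p q); rewrite !mxE (bigD1 (mxvec_index p q)) //=.
rewrite mxE fusion_mxE /fusion_coef leqnn subnn eqxx sing_coef0 mulr1.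
rewrite big1 ?addr0 // => s; case/mxvec_indexP: s => p' q' pq.
rewrite mxE fusion_mxE /fusion_coef.
case: ifP => [/andP[qq' /eqP pp']|_]; last by rewrite mulr0.
rewrite IH ?mul0r //; suff : (q < q')%N by lia.
rewrite ltn_neqAle qq' andbT; apply: contraNneq pq => eq.
by apply/eqP; congr mxvec_index; apply: val_inj => //=; lia.
Qed.

End CharZero.
End Fusion.

(** * Evaluation at lam = k on the weight subspace that occurs *)

Section Specialization.
Variable F : fieldType.
Hypothesis F0 : [pchar F] =i pred0.

Lemma map_ratcst_linear m n a (u v : 'M[F]_(m, n)) :
  map_mx (@ratcst F) (a *: u + v) =
  ratcst a *: map_mx (@ratcst F) u + map_mx (@ratcst F) v.
Proof.
by apply/matrixP=> i j; rewrite !mxE /ratcst polyCD polyCM tofracD tofracM.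
Qed.

Lemma map_ratcst0 m n : map_mx (@ratcst F) 0 = 0 :> 'M_(m, n).
Proof. by apply/matrixP=> i j; rewrite !mxE /ratcst polyC0 tofrac0. Qed.

Lemma map_ratcst_delta m n i j :
  map_mx (@ratcst F) (delta_mx i j) = delta_mx i j :> 'M_(m, n).
Proof.
apply/matrixP=> i' j'; rewrite !mxE /ratcst.
by case: (_ && _); rewrite ?polyC1 ?polyC0 ?tofrac0 ?tofrac1.
Qed.

Variables A B C K : nat.
Let k : F := K%:R / 2.
Let s := ((B + C + A - K)./2)%N.
Let p N := ((B + A - N)./2)%N.
Let q N := ((C + N - K)./2)%N.
Variable X : nat -> F.
Hypothesis X0 : forall N, ~~ (admissible N A B && admissible K N C) -> X N = 0.
Let lhs : tens (irr F B) C :=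
  \sum_(N < (A + B).+1) X N *: tensv (vv F B (p N)) (vv F C (q N)).
Let Y := fusion_mx F B C *m map_mx (@ratcst F) (coords lhs).

(** The triangle inequalities in terms of the indices; [q N <= N], which is C <= K + N, is what
    keeps the columns regular at [k]. *)
Lemma admissible_bounds N : X N != 0 ->
  [/\ (p N <= B)%N, (q N <= C)%N, (q N <= N)%N, (p N + q N = s)%N &
      (C + N = K + 2 * q N)%N].
Proof.
move=> XN; have : admissible N A B && admissible K N C.
  by apply: contraNT XN => /X0 ->.
by rewrite /admissible /p /q /s => adm; split; lia.
Qed.

Lemma lhs_support (i : 'I_B.+1) (j : 'I_C.+1) : (i + j != s)%N ->
  coords lhs (mxvec_index i j) ord0 = 0.
Proof.
move=> ij; rewrite coordsE !sum_ffunE big1 // => N _; rewrite !ffunE !vvE.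
have [->|/admissible_bounds [_ _ _ pq _]] := eqVneq (X N) 0.
  by rewrite [LHS]mul0r.
case: eqP => [ei|_]; case: eqP => [ej|_]; rewrite ?scale0r ?scaler0 //.
by move: ij; rewrite ei ej pq eqxx.
Qed.

(** The fusion matrix preserves the weight, that is, the sum of the two indices. *)
Lemma fusion_lhs_support (i : 'I_B.+1) (j : 'I_C.+1) : (i + j != s)%N ->
  Y (mxvec_index i j) ord0 = 0.
Proof.
move=> ij; rewrite mxE big1 // => t _; case/mxvec_indexP: t => i' j'.
rewrite [X in _ * X]mxE.
have [e|/lhs_support ->] := eqVneq (i' + j')%N s; last first.
  by rewrite /ratcst polyC0 tofrac0 mulr0.
rewrite fusion_mxE /fusion_coef; case: ifP => [|_]; last by rewrite mul0r.
by move: ij; rewrite -e => ij /andP[jj /eqP ii]; case/eqP: ij; lia.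
Qed.

(* J_bc is regular at k on the columns that occur: the pole of the column of
   v_{c,q} at 2 (k - lv) = n would need n < q, against c <= k + n. *)
Lemma ratval_fusion_lhs t :
  ratval (Y t ord0) k
    (coords (\sum_(N < (A + B).+1)
       X N *: sing_tens C N%:R (q N) (vv F B (p N))) t ord0).
Proof.
(* A relation closed under linear combinations, so the sum over [N] can be treated term by term. *)
pose P (u v : tens (irr F B) C) := forall t, ratval
  ((fusion_mx F B C *m map_mx (@ratcst F) (coords u)) t ord0) k (coords v t ord0).
have P0 : P 0 0.
  by move=> i; rewrite !linear0 map_ratcst0 mulmx0 !mxE; apply: ratval0.
have PD a u v u' v' : P u v -> P u' v' -> P (a *: u + u') (a *: v + v').
  move=> uv uv' i; rewrite !linearP map_ratcst_linear mulmxDr -scalemxAr.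
  rewrite [X in ratval X]mxE [X in ratval (X + _)]mxE.
  rewrite [X in ratval _ _ X]mxE [X in ratval _ _ (X + _)]mxE.
  exact: ratvalD (ratvalM (ratval_cst a k) (uv i)) (uv' i).
move: t; apply: (big_ind2 P) => // [u v u' v' uv uv'|N _].
  by rewrite -[u]scale1r -[v]scale1r; apply: PD.
rewrite -[_ *: tensv _ _]addr0 -[_ *: sing_tens _ _ _ _]addr0.
have [->|/admissible_bounds [pB qC qN _ eN]] := eqVneq (X N) 0.
  by rewrite !scale0r !addr0; apply: P0.
apply: PD => // t; have [pB' qC'] : (p N < B.+1)%N /\ (q N < C.+1)%N by [].
have := coords_vv F (Ordinal pB') (Ordinal qC'); rewrite /= => ->.
rewrite map_ratcst_delta -colE mxE.
have := ratval_fusion_mx F0 (Ordinal pB') (q := Ordinal qC') (x := k) t.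
rewrite /= horner_fusion_wt //.
(* At lam = k the weight of the intermediate Verma module becomes the highest weight of V_n, so the
   generic formula turns into the one for phi_k^{nc}. *)
have -> : 2 * (k - (C%:R / 2 - (q N)%:R)) = N%:R.
  have /(canRL (addKr _)) -> : C%:R + N%:R = K%:R + 2 * (q N)%:R :> F.
    by rewrite -natrD eN natrD natrM.
  by rewrite /k; field; exact: two_neq0.
apply=> i iq; apply/eqP => /(natr_inj F0); lia.
Qed.

(** The constant vector [lhs] equals J^{-1} Y over the function field; both sides are evaluated at
    [k] and compared by uniqueness of values. *)
Lemma regular_inverse_fusion : regular_on (invmx (fusion_mx F B C)) s k ->
  coords lhs = map_mx (rateval k) (invmx (fusion_mx F B C)) *m
    coords (\sum_(N < (A + B).+1)
       X N *: sing_tens C N%:R (q N) (vv F B (p N))).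
Proof.
set y := \sum_(_ < _) _; move=> reg.
have lhsE : map_mx (@ratcst F) (coords lhs) = invmx (fusion_mx F B C) *m Y.
  by rewrite /Y mulKmx // fusion_mx_unit.
apply/colP => t; apply: (@ratval_unique _ _ k _ _ (ratval_cst _ k)).
have -> : ratcst (coords lhs t 0) = (invmx (fusion_mx F B C) *m Y) t 0.
  by rewrite -lhsE [RHS]mxE.
rewrite [X in ratval X]mxE [X in ratval _ _ X]mxE; apply: ratval_sum => t'.
have := ratval_fusion_lhs t'; case/mxvec_indexP: t' => i j.
have [ij|/fusion_lhs_support Y0] := eqVneq (i + j)%N s => Yy.
  apply: ratvalM Yy; rewrite mxE; apply: ratval_rateval; exact: reg.
(* Off the weight subspace the inverse may have a pole, but there the entry of [Y] is identically
   zero. *)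
move: Yy; rewrite Y0 => /ratval0_unique ->; rewrite !mulr0; exact: ratval0.
Qed.

End Specialization.

Local Open Scope complex_scope.

(** The first clause reads J^{-1}(k) as the value at [k] of the inverse over the function field,
    where that is regular on the weight subspace; the second says that J(lam) applied to the left
    side has a value at [k], equal to the vector to which J^{-1}(k) is applied. *)
Theorem proposition53 (R : realType) (A B C J K : nat)
    (hJ : admissible J B C) (hK : admissible K A J) :
  let F : fieldType := R[i] in
  let k : F := K%:R / 2 in
  let s : nat := ((B + C + A - K)./2)%N in
  let lhs : tens (irr F B) C :=
    \sum_(N < (A + B).+1)
      sixj F A B N C K J *:
        tensv (vv F B (B + A - N)./2) (vv F C (C + N - K)./2) in
  let y : tens (irr F B) C := phi F J B C (vv F J (J + A - K)./2) in
  (regular_on (invmx (fusion F B C)) s k ->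
     coords lhs = map_mx (rateval k) (invmx (fusion F B C)) *m coords y) /\
  (forall t,
     ratval ((fusion F B C *m map_mx (@ratcst F) (coords lhs)) t ord0) k
       (coords y t ord0)).
Proof.
move=> F k s lhs y; have F0 : [pchar F] =i pred0 by exact: Num.Theory.pchar_num.
have X0 := (sixjP F0 hJ hK).1.
rewrite fusionE // /y (sixj_top F0 hJ hK); split.
  exact: (regular_inverse_fusion F0 X0).
exact: (ratval_fusion_lhs F0 X0).
Qed.
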